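(* Every valid history $H$ generated by the SF-KOSTM algorithm is locally opaque.
   Context: **Model.** Threads execute transactions $T_i$ on a shared hash table of keys. A transaction invokes the methods STM_begin, STM_lookup$(k)$, STM_delete$(k)$, STM_insert$(k,v)$, STM_tryC, STM_tryA. Return-value methods (rv-methods) are lookup and delete; they return the value of the key (possibly nil) or abort. Update methods are insert and delete; their effect on shared memory takes place at a successful tryC. A transaction ends by returning commit or abort and then invokes nothing else; a transaction that has done neither is live. A history $H$ is a totally ordered set of events of transactions, well-formed (a transaction invokes a method only after the previous one responded). Methods are treated as atomic, ordered by their linearization points (the first unlocking point of each successful method). An initial transaction $T_0$ commits before all others, all keys having value nil. $\overline H$ is the completion of $H$: abort is inserted immediately for every live transaction, except that a transaction whose tryC has successfully executed its first operation is made to commit. Histories are equivalent if they have the same events. $T_i\prec_H^{TR}T_j$ means $T_i$ terminates before $T_j$ begins. $S$ is serial if all its transactions are terminated and any two are ordered by $\prec_S^{TR}$. A history is valid if every rv-method on a key $k$ returns the value from some previously committed transaction that updated $k$; it is legal if every rv-method returns the value from the closest previous such transaction. **Opacity and local opacity.** A valid history $H$ is opaque if there is a serial $S$ with: (1) $S$ equivalent to $\overline H$; (2) $S$ legal; (3) $\prec_H^{TR}\subseteq\prec_S^{TR}$. The set $H.subhistSet$ consists of the following sub-histories: for each aborted transaction $T_i$, the sub-history with all events of the transactions committed previously, together with all successful events of $T_i$ (those which have not returned abort), with commit placed immediately after the last successful operation of $T_i$; and one further sub-history, for the last committed transaction $T_l$, with the events of $T_l$ and of all previously committed transactions only. $H$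 is locally opaque if every sub-history in $H.subhistSet$ is opaque. **Algorithm SF-KOSTM** (parameters: number of versions $K\ge1$, constant $C>0$, increment incrVal $\ge1$). Shared memory is a hash table with $M$ buckets, each a list sorted by key between two sentinels; a node has fields key, lock, mark (true = logically deleted), a version list vl, and two links: red links reach all nodes, blue links only unmarked nodes. A version has fields ts (timestamp), val (nil for versions created by delete), rvl (timestamps of transactions that read it), vrt (''version real time''), vNext (next version in ts order). At most $K$ versions per key are kept; creating a $(K+1)$-th overwrites the oldest. ''Locating $k$'' means finding, without locks, predecessor and current nodes of $k$ along the blue links and along the red links; then these nodes are locked in increasing key order and validated (rv_Validation: blue predecessor and blue current are unmarked, blue predecessor's blue link points to blue current, red predecessor's red link points to red current); if validation fails, release locks and retry. A global atomic counter gcounter is used. Each $T_i$ has a local log, timestamps $its_i,cts_i,wts_i$ (the identifier/timestamp $i$ is $wts_i$), limits $tltl_i,tutl_i$, and a status in {live, commit, false}. - *STM_begin(its)*: first incarnation: $its_i=cts_i=wts_i=$ gcounter.get&Inc(). Otherwise (retry of an aborted transaction): $its_i=its$ (that of the first incarnation), $cts_i=$ gcounter.get&Inc(), $wts_i=cts_i+C(cts_i-its_i)$. In both cases $tltl_i=cts_i$, $tutl_i=\infty$, status$_i$ = live. - *rv-method on $k$*: if $k$ is in the local log, update the log and answer from it. Otherwise, if status$_i$ = false, abort. Otherwise locate, lock, validate. If no node for $k$ exists, create a marked node, reachable only by red links, with one version (ts=0, val=nil, rvl=$\{i\}$, vrt=0); release locks, log $k$, return nil. If it exists, let $ver_j$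 be the version with the largest ts $j$ smaller than $i$; if none exists, abort. If $ver_j$ has a next version, set $tutl_i=\min(tutl_i,\,ver_j.vNext.vrt-1)$. Set $tltl_i=\max(tltl_i,\,ver_j.vrt+1)$. If $tltl_i>tutl_i$, abort. Otherwise add $i$ to $ver_j.rvl$, release locks, log, return $ver_j.val$. - *insert*: recorded in the local log. - *STM_tryC*: if status$_i$ = false, abort. For each logged update method in increasing key order: locate and lock, run tryC_Validation; if it fails, abort (releasing locks). Then apply each update (adjusting predecessor/current nodes changed by earlier updates of the same transaction): an insert of $v$ at an absent key creates an unmarked node reachable by red and blue links with the $T_0$-version (ts=0, val=nil, rvl=$\{i\}$, vrt=0) followed by the version (ts=$i$, val=$v$, rvl=$\emptyset$, vrt=$tltl_i$); an insert at a present key adds the version (ts=$i$, val=$v$, rvl=$\emptyset$, vrt=$tltl_i$), node unmarked and reachable by both links; a delete adds the version (ts=$i$, val=nil, rvl=$\emptyset$, vrt=$tltl_i$), node marked and reachable by red links only. Release locks, set status to commit, return commit. - *tryC_Validation*: perform rv_Validation (retry on failure). If a node for $k$ exists, let $ver_j$ be the version with the largest ts $j$ smaller than $i$; if none, abort. Collect, over the keys of $T_i$: currVL (the versions $ver_j$), nextVL (the next versions $ver_j.vNext$), allRVL (the entries of $ver_j.rvl$), largeRVL (those $>i$), smallRVL (those $<i$). Lock the statuses of all transactions in allRVL and of $T_i$ in a predefined order. If status$_i$ = false, fail. For each $p\in$ largeRVL: if $its_i<its_p$ and status$_p$ = live, put $p$ in abortRVL, else fail. For each $ver\in$ nextVL,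 $tutl_i=\min(tutl_i,\,ver.vrt-1)$. For each $ver\in$ currVL, $tltl_i=\max(tltl_i,\,ver.vrt+1)$. Set comTime$_i$ = gcounter.add&get(incrVal) and $tutl_i=\min(tutl_i,\text{comTime}_i)$. If $tltl_i>tutl_i$, fail. For each $p\in$ smallRVL with $tltl_p>tutl_i$: if $its_i<its_p$ and status$_p$ = live, put $p$ in abortRVL, else fail. Set $tltl_i=tutl_i$. For each live $p\in$ smallRVL, $tutl_p=\min(tutl_p,\,tltl_i-1)$. Set the status of every $p\in$ abortRVL to false. Succeed.
   Formalization: Methods answered by the local log are ordered right after their transaction's previous event; ''committed previously'' means before T_i's last successful operation; the commit inserted for an aborted T_i leaves its updates invisible to others; timestamps wts are assumed distinct. *)

(* Defs.v *)
From mathcomp Require Import all_boot all_order all_algebra.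

Set Implicit Arguments.
Unset Strict Implicit.
Unset Printing Implicit Defensive.

Import Order.TTheory GRing.Theory Num.Theory.

Local Open Scope ring_scope.

(* [Ret None] is the return value nil; [Aborted] is the abort response. *)
Inductive response (V : Type) : Type :=
| Ret of option V
| Aborted.
Arguments Aborted {V}.

(* Methods are atomic, so an event is a whole method execution together with
   its response.  [TryC i b] is a tryC of T_i answering commit (b = true) or
   abort (b = false).  [Commit i] and [Abort i] are never produced by an
   execution: they are the bare responses added when a history is completed
   or cut.  The initial transaction T_0 has no events; it is accounted for in
   [returns_committed] and [returns_latest]. *)
Inductive event (I K V : Type) : Type :=
| Begin of I
| Lookup of I & K & response V
| Delete of I & K & response V
| Insert of I & K & V
| TryC of I & bool
| TryA of I
| Commit of I
| Abort of I.
Arguments Begin {I K V}.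
Arguments Lookup {I K V}.
Arguments Delete {I K V}.
Arguments Insert {I K V}.
Arguments TryC {I K V}.
Arguments TryA {I K V}.
Arguments Commit {I K V}.
Arguments Abort {I K V}.

Section Opacity.

Variables (I K : eqType) (V : Type).

Local Notation event := (event I K V).
Local Notation history := (seq event).

Implicit Types (e : event) (H P Q G S : history) (i j : I) (k : K).

Definition txn e : I :=
  match e with
  | Begin i | Lookup i _ _ | Delete i _ _ | Insert i _ _
  | TryC i _ | TryA i | Commit i | Abort i => i
  end.

Definition aborts e : bool :=
  match e with
  | Lookup _ _ Aborted | Delete _ _ Aborted
  | TryC _ false | TryA _ | Abort _ => true
  | _ => false
  end.

Definition terminates e : bool :=
  aborts e || match e with TryC _ true | Commit _ => true | _ => false end.

Definition begins i e : bool := if e is Begin j then j == i else false.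

Definition tryC_commits i e : bool :=
  if e is TryC j true then j == i else false.

Definition live H i : bool :=
  ~~ has (fun e => (txn e == i) && terminates e) H.

Definition proj i H : history := [seq e <- H | txn e == i].

Definition returns e : option (I * K * option V) :=
  match e with
  | Lookup i k (Ret r) | Delete i k (Ret r) => Some (i, k, r)
  | _ => None
  end.

(* The value given to [k] by the last update method of T_i on [k] in [H], or
   [None] if there is none; [Some None] is a deletion. *)
Definition written i k H : option (option V) :=
  foldl (fun w e =>
    match e with
    | Insert j k' v => if (j == i) && (k' == k) then Some (Some v) else w
    | Delete j k' (Ret _) => if (j == i) && (k' == k) then Some None else w
    | _ => w
    end) None H.

(* The value of [k] according to T_i itself, once T_i has accessed [k]. *)
Definition own_view i k H : option (option V) :=
  foldl (fun w e =>
    match e with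
    | Insert j k' v => if (j == i) && (k' == k) then Some (Some v) else w
    | Delete j k' (Ret _) => if (j == i) && (k' == k) then Some None else w
    | Lookup j k' (Ret r) => if (j == i) && (k' == k) then Some r else w
    | _ => w
    end) None H.

(* Updates take effect at a successful tryC.  A transaction closed by a bare
   [Commit] has performed none, so its updates are invisible to the others:
   both notions below only look at [TryC j true].  The disjuncts [r = None]
   are the reads from T_0. *)
Definition returns_committed P k (r : option V) : Prop :=
  r = None \/ exists2 j, has (tryC_commits j) P & written j k P = Some r.

Definition returns_latest P k (r : option V) : Prop :=
  (r = None /\ forall j, has (tryC_commits j) P -> written j k P = None)
  \/ exists P1 P2 j,
       [/\ P = P1 ++ TryC j true :: P2,
           written j k P1 = Some r
         & forall j', has (tryC_commits j') P2 -> written j' k P = None].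

(* A method on a key that its transaction has already accessed must agree with
   the transaction's own view; [shared] constrains the other ones. *)
Definition reads_respect (shared : history -> K -> option V -> Prop) H : Prop :=
  forall P e Q i k r, H = P ++ e :: Q -> returns e = Some (i, k, r) ->
    if own_view i k P is Some r' then r = r' else shared P k r.

Definition valid H : Prop := reads_respect returns_committed H.

Definition legal H : Prop := reads_respect returns_latest H.

Definition precedes H i j : Prop :=
  exists P e Q,
    [/\ H = P ++ e :: Q, txn e = i, terminates e & has (begins j) Q].

Definition serial S : Prop :=
  (forall i, i \in map txn S -> ~~ live S i) /\
  (forall i j, i \in map txn S -> j \in map txn S -> i != j ->
     precedes S i j \/ precedes S j i).

(* Same events, those of each transaction being in the same (program) order. *)
Definition equivalent H S : Prop := forall i, proj i H = proj i S.

(* Insert [e] immediately after the last event of its transaction. *)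
Fixpoint place e H : history :=
  if H is x :: H' then
    if (txn x == txn e) && (txn e \notin map txn H') then x :: e :: H'
    else x :: place e H'
  else [:: e].

(* As tryC is one event, no live transaction is in the middle of a tryC, hence
   every live transaction is aborted. *)
Definition completion H : history :=
  foldr (fun i => place (Abort i)) H [seq i <- undup (map txn H) | live H i].

Definition opaque H : Prop :=
  valid H /\
  exists S, [/\ serial S, equivalent (completion H) S, legal S
              & forall i j, precedes H i j -> precedes S i j].

(* In [sub_aborted], [e] is the last successful event of the aborted T_i, so
   the commit lands right after it; the transactions committed previously are
   those committed before that point. *)
Inductive subhist H : history -> Prop :=
| sub_aborted P e Q :
    H = P ++ e :: Q -> ~~ aborts e ->
    all (fun x => (txn x == txn e) ==> aborts x) Q ->
    has (fun x => txn x == txn e) Q ->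
    subhist H
      (rcons [seq x <- rcons P e | has (tryC_commits (txn x)) P
                                   || (txn x == txn e)]
             (Commit (txn e)))
| sub_last_committed P l Q :
    H = P ++ TryC l true :: Q ->
    (forall j, ~~ has (tryC_commits j) Q) ->
    subhist H
      [seq x <- rcons P (TryC l true) | has (tryC_commits (txn x)) P
                                        || (txn x == l)].

Definition locally_opaque H : Prop := forall G, subhist H G -> opaque G.

End Opacity.

(* SF-KOSTM.  A transaction is named by its timestamp wts, which lives in an
   arbitrary ordered domain [R] so that the constant C need not be an integer;
   cts, its, vrt and the limits are natural numbers.  Since methods are atomic,
   locks are always granted and rv_Validation always succeeds, so neither is
   represented. *)
Section Algorithm.

Variables (R : realDomainType) (disp : Order.disp_t) (K : orderType disp).
Variables (V : Type) (M nversions incrVal : nat) (C : R) (hash : K -> 'I_M).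

(* The description of tryC runs tryC_Validation for every update key, but its
   lists range over all the keys of the transaction.  With [each_key = true]
   everything from the locking of the statuses on is run for every update key,
   on the lists collected so far; with [each_key = false] it is run once, for
   the last update key, on the complete lists. *)
Variable each_key : bool.

Record version := Version {
  ts : R; vval : option V; rvl : seq R; vrt : nat }.

(* [vl] is in ts order, so vNext is the next entry. *)
Record node := Node { nkey : K; mark : bool; vl : seq version }.

Inductive status := Live | Committed | StFalse.

(* [log] has at most one entry per key: the current value of the key for the
   transaction, and whether an update method has been applied to it.  For an
   update, the value [None] means delete.  [tutl = None] stands for infinity.
   [closed] tells that the transaction has returned commit or abort; a
   transaction whose status was set to false by another one is not closed
   yet. *)
Record txstate := TxState {
  its : nat; tltl : nat; tutl : option nat; stat : status;
  log : seq (K * (option V * bool)); closed : bool }.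

(* A bucket is the list of its nodes in red order (increasing keys, sentinels
   omitted); the blue list is the sublist of unmarked nodes. *)
Record state := State {
  gcounter : nat; table : 'I_M -> seq node;
  begun : seq R; tx : R -> txstate }.

Implicit Types (s : state) (i p : R) (k : K) (vs : seq version).
Implicit Types (t : txstate) (nd : node).

Definition is_live t := if stat t is Live then true else false.
Definition is_false t := if stat t is StFalse then true else false.

Definition set_limits t lo hi :=
  TxState (its t) lo hi (stat t) (log t) (closed t).
Definition set_stat t st :=
  TxState (its t) (tltl t) (tutl t) st (log t) (closed t).
Definition set_log t l :=
  TxState (its t) (tltl t) (tutl t) (stat t) l (closed t).
Definition close t st :=
  TxState (its t) (tltl t) (tutl t) st (log t) true.

Definition set_tx s i t :=
  State (gcounter s) (table s) (begun s)
        (fun j => if j == i then t else tx s j).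

Definition abort s i := set_tx s i (close (tx s i) StFalse).

Definition find_node s k : option node :=
  ohead [seq nd <- table s (hash k) | nkey nd == k].

Definition put_node s nd : state :=
  let b := hash (nkey nd) in
  let l := table s b in
  State (gcounter s)
        (fun c => if c == b then
                    [seq m <- l | (nkey m < nkey nd)%O]
                      ++ nd :: [seq m <- l | (nkey nd < nkey m)%O]
                  else table s c)
        (begun s) (tx s).

Definition position vs i : nat := find (fun v => i <= ts v) vs.

(* ver_j, for the largest j smaller than i, and ver_j.vNext *)
Definition find_version vs i : option (version * option version) :=
  if position vs i is n.+1 then
    if onth vs n is Some v then Some (v, onth vs n.+1) else None
  else None.

Definition add_version vs (v : version) : seq version :=
  let n := position vs (ts v) in
  let vs' := take n vs ++ v :: drop n vs in
  drop (size vs' - nversions) vs'.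

Definition add_reader vs j i : seq version :=
  [seq if ts v == j then Version (ts v) (vval v) (i :: rvl v) (vrt v) else v
  | v <- vs].

Definition initial_version i : version := Version 0 None [:: i] 0.

Definition min_limit (hi : option nat) (n : nat) : option nat :=
  Some (if hi is Some m then minn m n else n).

Definition exceeds (lo : nat) (hi : option nat) : bool :=
  if hi is Some m then (m < lo)%N else false.

Definition logged s i k : option (option V * bool) :=
  omap snd (ohead [seq x <- log (tx s i) | x.1 == k]).

Definition put_log s i k (w : option V) (upd : bool) : state :=
  set_tx s i (set_log (tx s i)
    ((k, (w, upd)) :: [seq x <- log (tx s i) | x.1 != k])).

Definition start s i (its0 : nat) : state :=
  State (gcounter s).+1 (table s) (i :: begun s)
    (fun j => if j == i
              then TxState its0 (gcounter s) None Live [::] false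
              else tx s j).

(* An rv-method on a key that is not in the log, up to the logging *)
Definition shared_read s i k : state * response V :=
  let t := tx s i in
  if is_false t then (abort s i, Aborted)
  else if find_node s k is Some nd then
    if find_version (vl nd) i is Some (v, next) then
      let hi := if next is Some w then min_limit (tutl t) (vrt w).-1
                else tutl t in
      let lo := maxn (tltl t) (vrt v).+1 in
      let s1 := set_tx s i (set_limits t lo hi) in
      if exceeds lo hi then (abort s1 i, Aborted)
      else (put_node s1 (Node k (mark nd) (add_reader (vl nd) (ts v) i)),
            Ret (vval v))
    else (abort s i, Aborted)
  else (put_node s (Node k true [:: initial_version i]), Ret None).

Definition log_read (del : bool) s i k (r : response V) : state :=
  if r is Ret w then
    if del then put_log s i k None true else put_log s i k w false
  else s.

(* The part of tryC_Validation that starts with the locking of the statuses;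
   [col] lists the collected pairs (ver_j, ver_j.vNext). *)
Definition check s i (col : seq (version * option version)) : state * bool :=
  let t := tx s i in
  let allRVL := flatten [seq rvl c.1 | c <- col] in
  let largeRVL := [seq p <- allRVL | i < p] in
  let smallRVL := [seq p <- allRVL | p < i] in
  let can_abort p := (its t < its (tx s p))%N && is_live (tx s p) in
  if is_false t then (s, false)
  else if ~~ all can_abort largeRVL then (s, false)
  else
    let hi0 := foldl min_limit (tutl t)
                 [seq (vrt w).-1 | w <- pmap snd col] in
    let lo := foldl maxn (tltl t) [seq (vrt c.1).+1 | c <- col] in
    let comTime := (gcounter s + incrVal)%N in
    let hi := if hi0 is Some m then minn m comTime else comTime in
    let s1 := State comTime (table s) (begun s)
                (fun j => if j == i then set_limits t lo (Some hi)
                          else tx s j) in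
    let late := [seq p <- smallRVL | (hi < tltl (tx s p))%N] in
    if (hi < lo)%N then (s1, false)
    else if ~~ all can_abort late then (s1, false)
    else
      let abortRVL := largeRVL ++ late in
      let update p :=
        let tp := tx s p in
        if p == i then set_limits t hi (Some hi)
        else
          let tp1 := if (p \in smallRVL) && is_live tp
                     then set_limits tp (tltl tp) (min_limit (tutl tp) hi.-1)
                     else tp in
          if p \in abortRVL then set_stat tp1 StFalse else tp1 in
      (State comTime (table s) (begun s) update, true).

Fixpoint validate s i (col : seq (version * option version)) (ks : seq K) :
    state * bool :=
  if ks is k :: ks' then
    let go col' :=
      if each_key || nilp ks' then
        let: (s', ok) := check s i col' in
        if ok then validate s' i col' ks' else (s', false)
      else validate s i col' ks' in
    if find_node s k is Some nd then
      if find_version (vl nd) i is Some c then go (rcons col c)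
      else (s, false)
    else go col
  else (s, true).

(* A delete may find no node at all (an insert then a delete of a fresh key,
   both answered by the log); the node is then created as for an insert. *)
Definition apply_update i s (u : K * option V) : state :=
  let vs := if find_node s u.1 is Some nd then vl nd
            else [:: initial_version i] in
  put_node s
    (Node u.1 (~~ isSome u.2)
       (add_version vs (Version i u.2 [::] (tltl (tx s i))))).

Definition updates s i : seq (K * option V) :=
  sort (fun x y => (x.1 <= y.1)%O)
    [seq (x.1, x.2.1) | x <- log (tx s i) & x.2.2].

Definition tryC s i : state * bool :=
  if is_false (tx s i) then (abort s i, false)
  else
    let us := updates s i in
    let: (s1, ok) := validate s i [::] (map fst us) in
    if ok then
      let s2 := foldl (apply_update i) s1 us in
      (set_tx s2 i (close (tx s2 i) Committed), true)
    else (abort s1 i, false).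

Definition can_invoke s i : bool := (i \in begun s) && ~~ closed (tx s i).

Definition has_aborted t : bool := closed t && is_false t.

Definition wts (its0 cts0 : nat) : R :=
  cts0%:R + C * (cts0%:R - its0%:R).

(* The counter starts at 1 because timestamp 0 is that of T_0. *)
Definition init : state :=
  State 1 (fun _ => [::]) [::]
        (fun _ => TxState 0 0 None Live [::] false).

Local Notation history := (seq (event R K V)).

(* [execution s H]: the state [s] is reachable with history [H].  A method
   served by the log alone (an insert, or an rv-method on a logged key) takes
   no lock and so has no unlocking point of its own; it can be executed at any
   time, and is linearised with the preceding method of its transaction
   ([place]).  A timestamp names a single transaction, hence the freshness
   conditions.  A retry requires that all the earlier incarnations have
   aborted. *)
Inductive execution : state -> history -> Prop :=
| exec_init : execution init [::]
| exec_begin s H :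
    execution s H ->
    let i := wts (gcounter s) (gcounter s) in
    i \notin begun s ->
    execution (start s i (gcounter s)) (rcons H (Begin i))
| exec_retry s H a :
    execution s H -> a \in begun s ->
    (forall b, b \in begun s -> its (tx s b) = its (tx s a) ->
       has_aborted (tx s b)) ->
    let i := wts (its (tx s a)) (gcounter s) in
    i \notin begun s ->
    execution (start s i (its (tx s a))) (rcons H (Begin i))
| exec_lookup_log s H i k w upd :
    execution s H -> can_invoke s i -> logged s i k = Some (w, upd) ->
    execution s (place (Lookup i k (Ret w)) H)
| exec_delete_log s H i k w upd :
    execution s H -> can_invoke s i -> logged s i k = Some (w, upd) ->
    execution (put_log s i k None true) (place (Delete i k (Ret w)) H)
| exec_lookup s H i k s' r :
    execution s H -> can_invoke s i -> logged s i k = None ->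
    shared_read s i k = (s', r) ->
    execution (log_read false s' i k r) (rcons H (Lookup i k r))
| exec_delete s H i k s' r :
    execution s H -> can_invoke s i -> logged s i k = None ->
    shared_read s i k = (s', r) ->
    execution (log_read true s' i k r) (rcons H (Delete i k r))
| exec_insert s H i k v :
    execution s H -> can_invoke s i ->
    execution (put_log s i k (Some v) true) (place (Insert i k v) H)
| exec_tryC s H i s' b :
    execution s H -> can_invoke s i -> tryC s i = (s', b) ->
    execution s' (rcons H (TryC i b))
| exec_tryA s H i :
    execution s H -> can_invoke s i ->
    execution (abort s i) (rcons H (TryA i)).

Definition generated (H : history) : Prop := exists s, execution s H.

End Algorithm.

(* Main.v *)
Require Import Defs.
From mathcomp Require Import all_boot all_order all_algebra.
From mathcomp Require Import zify.
From Stdlib Require List.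

(* Every transaction p carries a key (sg p, kp p), ordered lexicographically:
   sg p is a point of its time interval [tltl, tutl] (its cts, raised to the vrt
   of each version it reads, and finally the vrt of the versions it creates),
   and kp p is the moment of the last change of the key.  Serialising by key
   respects real time because gcounter bounds every sg from above.  It is legal
   because the vrt of the versions of a key increase with their ts, and because
   a committing writer aborts the readers of the version it supersedes whose
   timestamps exceed its own, and lies after the other readers, whose upper
   limits it lowers.  The second component is needed because transactions may
   share the same time; a read-only transaction may even commit with
   tutl = tltl - 1. *)

Set Implicit Arguments.
Unset Strict Implicit.
Unset Printing Implicit Defensive.

Import Order.TTheory GRing.Theory Num.Theory.

Local Open Scope ring_scope.

(** A method served by the log is inserted in the middle of the history by [place], so a prefix of a
    generated history need not be the history of any earlier state of the same execution. The
    sub-histories are therefore not handled along the execution: the invariant speaks of the whole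
    history, and every cut is serialised with the keys reached at the end. This forces the invariant
    to keep enough about aborted transactions: their keys are frozen, and what they have read stays
    consistent with the commits that precede their last success, which is what [sees] records. Since
    an overwritten version takes its list of readers with it, the versions read are remembered in
    the ghost map [rd]. *)

Local Notation In := List.In.

(** * Histories *)

Lemma cat_eq_split (A : Type) (s1 s2 P Q : seq A) e :
  s1 ++ s2 = P ++ e :: Q ->
  (exists B, s1 = P ++ e :: B) \/
  (exists2 B, P = s1 ++ B & s2 = B ++ e :: Q).
Proof.
elim: s1 P => [|x s1 IH] [|y P] /= E.
- by right; exists [::].
- by right; exists (y :: P).
- by case: E => <- _; left; exists s1.
case: E => -> E; case: (IH _ E) => [[B ->]|[B -> ->]]; first by left; exists B.
by right; exists B.
Qed.

Lemma rcons_eq_split (A : Type) (s P Q : seq A) x e :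
  rcons s x = P ++ e :: Q ->
  [/\ s = P, x = e & Q = [::]] \/ (exists B, s = P ++ e :: B).
Proof.
rewrite -cats1 => E; case: (cat_eq_split E) => [|[B ->]]; first by right.
by case: B => [|y [|? ?]] //= [-> <-]; left; rewrite cats0.
Qed.

Lemma flatten_eq_split (A : eqType) (T : Type) (f : A -> seq T) L P e Q :
  flatten [seq f i | i <- L] = P ++ e :: Q ->
  exists L1 q L2 B1 B2,
    [/\ L = L1 ++ q :: L2, f q = B1 ++ e :: B2
      & P = flatten [seq f i | i <- L1] ++ B1].
Proof.
elim: L P => [|i L IH] P /=; first by case: P.
move=> E; case: (cat_eq_split E) => [[B def]|[B -> /IH [L1 [q [L2 [B1 [B2 [-> def ->]]]]]]]].
  by exists [::], i, L, P, B.
by exists (i :: L1), q, L2, B1, B2; rewrite /= catA.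
Qed.

Lemma has_split (T : Type) (a : pred T) (l : seq T) :
  has a l -> exists B e Q, l = B ++ e :: Q /\ a e.
Proof.
elim: l => [|y l IH] //=; case: (boolP (a y)) => [ay _|_ /IH [B [e [Q [-> ae]]]]].
  by exists [::], y, l.
by exists (y :: B), e, Q.
Qed.

Lemma filter_eq_split (T : Type) (a : pred T) (l P Q : seq T) e :
  filter a l = P ++ e :: Q -> exists P' Q', l = P' ++ e :: Q' /\ P = filter a P'.
Proof.
elim: l P => [|y l IH] P /=; first by case: P.
case ay: (a y) => E; last first.
  by have [P' [Q' [-> ->]]] := IH _ E; exists (y :: P'), Q'; rewrite /= ay.
case: P E => [|z P] /= [<- E]; first by exists [::], l.
by have [P' [Q' [-> ->]]] := IH _ E; exists (y :: P'), Q'; rewrite /= ay.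
Qed.

(** * Order of occurrence of events *)

Section Before.
Variables (T : Type).
Implicit Types (a b p : pred T) (H P Q : seq T).

(** A boolean form of temporal precedence, shared by the real-time order and the visibility of
    commits. It computes on [rcons], by which histories grow. *)
Fixpoint before a b H :=
  if H is x :: H' then (a x && has b H') || before a b H' else false.

Lemma before_rcons a b H x :
  before a b (rcons H x) = before a b H || (has a H && b x).
Proof.
elim: H => [|y H IH] //=; first by rewrite andbF.
by rewrite IH has_rcons; case: (a y); case: (has b H); case: (b x);
  case: (before a b H); case: (has a H).
Qed.

Lemma before_has a b H : before a b H -> has a H /\ has b H.
Proof.
elim: H => [|y H IH] //= /orP [/andP [-> ->]|/IH [-> ->]]; by rewrite !orbT.
Qed.

Lemma before_cat a b P e Q : has a P -> b e -> before a b (P ++ e :: Q).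
Proof.
elim: P => [|y P IH] //= /orP [-> be|ha be]; first by rewrite has_cat /= be !orbT.
by rewrite IH // orbT.
Qed.

(** The witness of [b] is at [e] or earlier, so the witness of [a] lies strictly before [e]. *)
Lemma before_cat_has a b P e Q :
  before a b (P ++ e :: Q) -> ~~ has b Q -> has a P.
Proof.
elim: P => [|y P IH] /=.
  by move=> /orP [/andP [_ ->]|/before_has [_ ->]].
by move=> /orP [/andP [->]|/IH h /h ->] //; rewrite orbT.
Qed.

Lemma before_filter a b p H : before a b (filter p H) -> before a b H.
Proof.
elim: H => [|y H IH] //=; case: ifP => _ /=; last by move=> /IH ->; rewrite orbT.
case/orP=> [/andP [-> h]|/IH ->]; last by rewrite orbT.
suff -> : has b H by [].
by move: h; rewrite !has_count count_filter => /leq_trans; apply; apply: sub_count => x /andP [].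
Qed.

Lemma before_catl a b P Q : before a b P -> before a b (P ++ Q).
Proof.
elim: P => [|y P IH] //= /orP [/andP [-> h]|/IH ->]; last by rewrite orbT.
by rewrite has_cat h.
Qed.

End Before.

(** * Projections, writes and serialisation *)

Section Histories.
Variables (I K : eqType) (V : Type).
Local Notation event := (event I K V).
Local Notation txns := (map (@txn I K V)).
Implicit Types (x e : event) (H P Q G S B : seq event) (i j q : I) (k : K).

Lemma proj_cat i P Q : proj i (P ++ Q) = proj i P ++ proj i Q.
Proof. exact: filter_cat. Qed.

Lemma proj_rcons i H x :
  proj i (rcons H x) = if txn x == i then rcons (proj i H) x else proj i H.
Proof. exact: filter_rcons. Qed.

Lemma proj_id i j H : proj i (proj j H) = if i == j then proj i H else [::].
Proof.
rewrite /proj -filter_predI; case: eqP => [->|ij].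
  by apply: eq_filter => x /=; rewrite andbb.
apply: size0nil; rewrite size_filter.
rewrite (eq_count (a2 := pred0)) ?count_pred0 // => x /=.
by case: (txn x =P i) => // ->; case: eqP.
Qed.

Lemma proj_nil i H : i \notin txns H -> proj i H = [::].
Proof.
elim: H => [|x H IH] //=; rewrite inE negb_or eq_sym => /andP [/negbTE -> /IH].
by [].
Qed.

Lemma mem_txn i H : (i \in txns H) = has (fun x => txn x == i) H.
Proof. by elim: H => [|x H IH] //=; rewrite inE IH eq_sym. Qed.

(** Whatever depends on projections alone cannot tell [place] from [rcons]; only relations between
    different transactions need [before_place]. *)
Lemma proj_place i x H : proj i (place x H) = proj i (rcons H x).
Proof.
rewrite proj_rcons; elim: H => [|y H IH] /=; first by case: ifP.
case: ifP => [/andP [/eqP E nin]|_] /=; last first.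
  by rewrite IH; case: ifP; case: ifP.
rewrite E; case: eqP => [<-|] //=; by rewrite proj_nil.
Qed.

Lemma has_place p x H : has p (place x H) = p x || has p H.
Proof.
elim: H => [|y H IH] //=; case: ifP => _ /=; rewrite ?IH orbCA //.
Qed.

Lemma has_proj i (p : pred event) H : (forall x, p x -> txn x = i) ->
  has p (proj i H) = has p H.
Proof.
move=> hp; elim: H => [|x H IH] //=; case: eqP => [_|ne] /=; rewrite IH //.
by case: (boolP (p x)) => // /hp.
Qed.

Lemma has_in_proj i (p : pred event) H :
  has p (proj i H) = has (fun x => (txn x == i) && p x) H.
Proof. by elim: H => [|x H IH] //=; case: eqP => _ /=; rewrite IH. Qed.

Lemma begins_txn i x : begins i x -> txn x = i.
Proof. by case: x => //= j /eqP. Qed.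

Lemma tryC_commits_txn i x : tryC_commits i x -> txn x = i.
Proof. by case: x => //= j [] // /eqP. Qed.

Lemma tryC_commits_terminates i x : tryC_commits i x -> terminates x.
Proof. by case: x => //= j []. Qed.

Lemma mem_txn_proj i H : (i \in txns H) = ~~ nilp (proj i H).
Proof. by rewrite mem_txn has_count /nilp size_filter lt0n. Qed.

(** The fold bodies of [written] and [own_view] get names so that an appended event acts by one
    step. *)
Definition write_step i k (w : option (option V)) e :=
  match e with
  | Insert j k' v => if (j == i) && (k' == k) then Some (Some v) else w
  | Delete j k' (Ret _) => if (j == i) && (k' == k) then Some None else w
  | _ => w
  end.

Definition view_step i k (w : option (option V)) e :=
  match e with
  | Insert j k' v => if (j == i) && (k' == k) then Some (Some v) else w
  | Delete j k' (Ret _) => if (j == i) && (k' == k) then Some None else w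
  | Lookup j k' (Ret r) => if (j == i) && (k' == k) then Some r else w
  | _ => w
  end.

Lemma written_rcons i k H x : written i k (rcons H x) = write_step i k (written i k H) x.
Proof. by rewrite /written foldl_rcons. Qed.

Lemma own_view_rcons i k H x :
  own_view i k (rcons H x) = view_step i k (own_view i k H) x.
Proof. by rewrite /own_view foldl_rcons. Qed.

Lemma write_step_other i k w x : txn x != i -> write_step i k w x = w.
Proof. by case: x => //= [j k' [r|]|j k' v] // /negbTE ->. Qed.

Lemma view_step_other i k w x : txn x != i -> view_step i k w x = w.
Proof. by case: x => //= [j k' [r|]|j k' [r|]|j k' v] // /negbTE ->. Qed.

Lemma written_proj i k H : written i k (proj i H) = written i k H.
Proof.
elim/last_ind: H => [|H x IH] //; rewrite proj_rcons.
case: eqP => [E|/eqP ne]; rewrite !written_rcons ?IH //.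
by rewrite write_step_other.
Qed.

Lemma own_view_proj i k H : own_view i k (proj i H) = own_view i k H.
Proof.
elim/last_ind: H => [|H x IH] //; rewrite proj_rcons.
case: eqP => [E|/eqP ne]; rewrite !own_view_rcons ?IH //.
by rewrite view_step_other.
Qed.

Lemma proj_flatten i G L : uniq L ->
  proj i (flatten [seq proj j G | j <- L]) = if i \in L then proj i G else [::].
Proof.
elim: L => [|j L IH] //= /andP [nin /IH E].
rewrite proj_cat E proj_id inE; case: eqP => [->|_] //=.
by rewrite (negbTE nin) cats0.
Qed.

(** The new event cannot be the earlier witness. If it is the later one, the event of its
    transaction just before it also satisfies [b] and is not itself an [a], so it can take over that
    role. *)
Lemma before_place (a b : pred event) x H :
  ~~ a x -> all (fun y => (txn y == txn x) ==> ~~ a y) H ->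
  (b x -> all (fun y => (txn y == txn x) ==> b y) H) ->
  txn x \in txns H -> before a b (place x H) = before a b H.
Proof.
move=> /negbTE ax; elim: H => [|y H IH] //= /andP [ay aH] bH; rewrite inE.
case: ifP => [/andP [/eqP E nin] _|/negbT h xin] /=.
  by move: ay; rewrite E eqxx ax /= => /negbTE ->.
have xH : txn x \in txns H.
  by move: h; rewrite negb_and negbK eq_sym; case/orP: xin => // ->.
rewrite IH // => [|/bH /andP [] //]; rewrite has_place.
case: (boolP (b x)) => //= /bH /andP [_ bxH]; congr (_ && _ || _); symmetry.
elim: (H) xH bxH => [|z l IHl] //=; rewrite inE => /orP [/eqP <-|/IHl h2] /andP [].
  by rewrite eqxx /= => ->.
by move=> _ /h2 ->; rewrite orbT.
Qed.

Lemma precedes_before H i j : precedes H i j ->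
  before (fun e => (txn e == i) && terminates e) (begins j) H.
Proof.
case=> P [e [Q [-> <- te hb]]]; elim: P => [|y P IH] /=; last by rewrite IH orbT.
by rewrite eqxx te hb.
Qed.

(** Legality of a read in terms of the order: no committed writer lies strictly between the source
    and the reader. The reader [q] is exempt because its own commit comes after its reads. *)
Definition source G (lt : rel I) q k (r : option V) : Prop :=
  (r = None /\ forall i, has (tryC_commits i) G -> i != q ->
                 written i k G <> None -> lt q i)
  \/ exists j, [/\ has (tryC_commits j) G, lt j q, written j k G = Some r
       & forall i, has (tryC_commits i) G -> i != q ->
           written i k G <> None -> [\/ i = j, lt i j | lt q i]].

(** The serial history is the concatenation of the projections in the order [lt], so real time and
    legality both reduce to comparisons by [lt]. *)
Lemma opaque_of_order G (lt : rel I) :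
  irreflexive lt -> transitive lt ->
  {in txns G &, forall i j, i != j -> lt i j || lt j i} ->
  valid G ->
  (forall i, i \in txns G -> has (begins i) G) ->
  (forall i, i \in txns G -> exists B t,
     [/\ proj i G = rcons B t, terminates t & ~~ has (@terminates I K V) B]) ->
  (forall i j, precedes G i j -> lt i j) ->
  (forall q B1 e B2 k r, proj q G = B1 ++ e :: B2 -> returns e = Some (q, k, r) ->
     if own_view q k B1 is Some r' then r = r' else source G lt q k r) ->
  opaque G.
Proof.
move=> irr tr tot vG beg trm prec rds; split=> //.
(* Sorting wants totality, also on the diagonal; strictness is recovered from [uL]. *)
pose le i j := (i == j) || lt i j.
pose L := sort le (undup (txns G)).
have memL i : (i \in L) = (i \in txns G) by rewrite mem_sort mem_undup.
have uL : uniq L by rewrite sort_uniq undup_uniq.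
have sL : pairwise le L.
  have tle : transitive le.
    move=> j i l /orP [/eqP -> //|ij] /orP [/eqP <-|jl]; rewrite /le ?ij ?orbT //.
    by rewrite (tr _ _ _ ij jl) orbT.
  rewrite -(sorted_pairwise tle).
  apply: (sort_sorted_in (P := [in txns G])); last by apply/allP=> i; rewrite mem_undup.
  move=> i j ii jj; rewrite /le (eq_sym j); case: (eqVneq i j) => //= ne.
  exact: tot.
have ltL L1 q L2 : L = L1 ++ q :: L2 ->
    (forall i, i \in L1 -> lt i q) /\ (forall i, i \in L2 -> lt q i).
  move=> E; move: sL uL; rewrite E pairwise_cat cat_uniq /= => /and3P [/allrelP a _ /andP [/allP b _]].
  case/and3P=> _ /norP [qn /hasPn _] /andP [qn2 _]; split=> i iL.
    have /orP [/eqP Ei|//] := a i q iL (mem_head _ _).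
    by rewrite -Ei iL in qn.
  by have /orP [/eqP Ei|//] := b i iL; rewrite Ei iL in qn2.
pose S := flatten [seq proj i G | i <- L].
have pS i : proj i S = proj i G.
  rewrite proj_flatten // memL; case: ifP => // /negbT ni; by rewrite proj_nil.
have mS i : (i \in txns S) = (i \in txns G).
  by rewrite !mem_txn_proj pS.
have pre i j : i \in txns G -> j \in txns G -> lt i j -> precedes S i j.
  move=> iG jG ij.
  have [B [t [Ei tt _]]] := trm i iG.
  have : i \in L by rewrite memL.
  case/splitPr E: {1}L / => [L1 L2].
  have [_ _] := ltL _ _ _ E; have [l1 l2] := ltL _ _ _ E.
  have jL2 : j \in L2.
    have : j \in L by rewrite memL.
    rewrite E mem_cat inE => /or3P [/l1 ji|/eqP Eij|//].
      by have := tr _ _ _ ij ji; rewrite irr.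
    by rewrite Eij irr in ij.
  exists (flatten [seq proj i0 G | i0 <- L1] ++ B), t, (flatten [seq proj i0 G | i0 <- L2]).
  split=> //.
  - by rewrite /S E map_cat flatten_cat /= Ei -cats1 -!catA.
  - have : all (fun x => txn x == i) (rcons B t) by rewrite -Ei filter_all.
    by rewrite all_rcons => /andP [/eqP].
  - have hb : has (begins j) (proj j G) by rewrite has_proj ?beg // => x; apply: begins_txn.
    case/splitPr: jL2 => A1 A2; rewrite map_cat flatten_cat /= !has_cat hb !orbT //.
have lv i : i \in txns G -> ~~ live G i.
  move=> iG; rewrite negbK; have [B [t [E tt _]]] := trm i iG.
  by rewrite -has_in_proj E has_rcons tt orTb.
(* Every transaction already ends by a terminating event, so there is nothing to close. *)
have cG : completion G = G.
  rewrite /completion; set l := filter _ _.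
  suff -> : l = [::] by [].
  apply/eqP; rewrite -[_ == _]negbK -has_filter; apply/hasPn => i; rewrite mem_undup.
  exact: lv.
exists S; split.
- split=> [i|i j]; rewrite !mS => iG.
    by have [B [t [E tt _]]] := trm i iG; rewrite negbK -has_in_proj pS E has_rcons tt orTb.
  move=> jG ne; case/orP: (tot i j iG jG ne) => h; [left|right]; exact: pre.
- by rewrite cG => i; rewrite pS.
(* Legality: a read is preceded by the full blocks of the smaller transactions, [L1], and by the
   beginning [B1] of the block of [q]. *)
- move=> P e Q q k r ES re.
  have [L1 [q' [L2 [B1 [B2 [EL Eq EP]]]]]] := flatten_eq_split ES.
  have Eqq : q' = q.
    have : all (fun x => txn x == q') (B1 ++ e :: B2) by rewrite -Eq filter_all.
    rewrite all_cat /= => /and3P [_ /eqP <- _].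
    by case: (e) re => //= [? ? [?|]|? ? [?|]] // [-> _ _].
  rewrite {q'}Eqq in EL Eq.
  have [l1 l2] := ltL _ _ _ EL.
  have uL1 : uniq L1 by move: uL; rewrite EL cat_uniq => /and3P [].
  have qL1 : q \notin L1.
    by apply/negP => /l1; rewrite irr.
  have B1q : proj q B1 = B1.
    have : all (fun x => txn x == q) (B1 ++ e :: B2) by rewrite -Eq filter_all.
    by rewrite all_cat => /andP [/all_filterP].
  have B1o i : i != q -> proj i B1 = [::] by move=> ne; rewrite -B1q proj_id (negbTE ne).
  have pP i : proj i P = if i == q then B1 else if i \in L1 then proj i G else [::].
    rewrite EP proj_cat proj_flatten //.
    case: eqP => [->|/eqP ne]; first by rewrite (negbTE qL1) B1q.
    by rewrite B1o // cats0.
  (* A commit in [P] comes from [L1]: [B1] stops before the end of its block, where the only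
     terminating event of [q] stands. *)
  have cP i : has (tryC_commits i) P -> [/\ i \in L1, has (tryC_commits i) G & written i k P = written i k G].
    rewrite -(has_proj P (@tryC_commits_txn i)) pP.
    have [->|ne] := eqVneq i q.
      move=> h; exfalso.
      have qG : q \in txns G by rewrite -memL EL mem_cat inE eqxx orbT.
      have [B [t [E2 tt /negP nt]]] := trm q qG.
      have [[_ EE _]|[B3 EB]] := rcons_eq_split (etrans (esym E2) Eq).
        by move: tt re; rewrite EE; case: (e) => // [? ? []|? ? []].
      by apply: nt; rewrite EB has_cat (sub_has (@tryC_commits_terminates q) h).
    case: ifP => // iL1; rewrite has_proj; last exact: tryC_commits_txn.
    split=> //; by rewrite -written_proj pP (negbTE ne) iL1 written_proj.
  have -> : own_view q k P = own_view q k B1.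
    by rewrite -own_view_proj pP eqxx.
  have := rds q B1 e B2 k r Eq re; case: (own_view q k B1) => // src.
  case: src => [[-> h]|[j [cj jq wj h]]].
    left; split=> // i /cP [iL1 ci ->].
    case E: (written i k G) => [w|//].
    have iq := l1 _ iL1; have ne : i != q by apply: contraTneq iq => ->; rewrite irr.
    have qi : lt q i by apply: h => //; rewrite E.
    by have := tr _ _ _ iq qi; rewrite irr.
  have jG : j \in txns G.
    rewrite mem_txn; apply: sub_has cj => x /tryC_commits_txn ->; exact: eqxx.
  have jL1 : j \in L1.
    have : j \in L by rewrite memL.
    rewrite EL mem_cat inE => /or3P [//|/eqP Ej|/l2 qj].
      by rewrite Ej irr in jq.
    by have := tr _ _ _ jq qj; rewrite irr.
  have [B [t [Ej tt nB]]] := trm j jG.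
  have Et : t = TryC j true.
    move: cj; rewrite -(has_proj G (@tryC_commits_txn j)) Ej has_rcons => /orP [|h'].
      by case: (t) => //= j' [] // /eqP ->.
    case/negP: nB; apply: sub_has h' => x; exact: tryC_commits_terminates.
  (* Cut at the block of the source [j]: a later commit in [P] then comes from [L12], strictly
     between [j] and [q], where [source] allows no writer. *)
  have [L11 [L12 EL1]] : exists L11 L12, L1 = L11 ++ j :: L12.
    by case/splitPr: jL1 => a b; exists a, b.
  right; exists (flatten [seq proj i G | i <- L11] ++ B), (flatten [seq proj i G | i <- L12] ++ B1), j.
  have EL' : L = L11 ++ j :: (L12 ++ q :: L2) by rewrite EL EL1 -catA.
  have [k1 k2] := ltL _ _ _ EL'.
  have uL11 : uniq L11 by move: uL1; rewrite EL1 cat_uniq => /and3P [].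
  have Bj : proj j B = B.
    have : all (fun x => txn x == j) (rcons B t) by rewrite -Ej filter_all.
    by rewrite all_rcons => /andP [_ /all_filterP].
  split.
  + by rewrite EP EL1 map_cat flatten_cat /= Ej Et -cats1 -!catA.
  + rewrite -written_proj proj_cat proj_flatten // ifN; last by apply/negP => /k1; rewrite irr.
    rewrite /= Bj; move: wj; rewrite -(written_proj j k G) Ej written_rcons Et /=.
    by [].
  move=> i ci.
  have ci' : has (tryC_commits i) P.
    by rewrite EP EL1 map_cat flatten_cat /= -!catA !has_cat in ci *; case/orP: ci => ->; rewrite !orbT.
  have [iL1 ciG ->] := cP i ci'.
  case E: (written i k G) => [w|//].
  have iq := l1 _ iL1.
  have ne : i != q by apply: contraTneq iq => ->; rewrite irr.
  have iL12 : i \in L12.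
    move: ci; rewrite -(has_proj _ (@tryC_commits_txn i)) proj_cat B1o // cats0 proj_flatten.
      by case: ifP.
    by move: uL1; rewrite EL1 cat_uniq /= => /and4P [].
  have ji : lt j i by apply: k2; rewrite mem_cat iL12.
  case: (h i ciG ne); first by rewrite E.
  + by move=> Eij; rewrite Eij irr in ji.
  + by move=> ij; have := tr _ _ _ ij ji; rewrite irr.
  + by move=> qi; have := tr _ _ _ iq qi; rewrite irr.
- move=> i j h; have ij := prec i j h.
  case: h => P [e [Q [E te tm hb]]].
  apply: pre => //.
    by rewrite E map_cat mem_cat /= inE te eqxx orbT.
  rewrite E map_cat mem_cat /= inE; apply/orP; right; apply/orP; right.
  rewrite mem_txn; apply: sub_has hb => x /begins_txn ->; exact: eqxx.
Qed.

End Histories.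

(** * Operations of the algorithm *)

Section Lists.
Variables (T : Type).

Lemma In_rcons (s : seq T) x y : In y (rcons s x) <-> y = x \/ In y s.
Proof. by rewrite -cats1 List.in_app_iff /=; intuition. Qed.

Lemma In_flatten_map (A : eqType) (f : T -> seq A) s c p :
  In c s -> p \in f c -> p \in flatten [seq f x | x <- s].
Proof.
elim: s => [|x s IH] //= [->|/IH h]; rewrite mem_cat => pc; first by rewrite pc.
by rewrite h ?orbT.
Qed.

Lemma In_map_mem (A : eqType) (f : T -> A) s c : In c s -> f c \in [seq f x | x <- s].
Proof. by elim: s => [|x s IH] //= [->|/IH h]; rewrite inE ?eqxx ?h ?orbT. Qed.

Lemma mem_map_In (A : eqType) (f : T -> A) s a :
  a \in [seq f x | x <- s] -> exists2 c, In c s & f c = a.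
Proof.
elim: s => [|x s IH] //=; rewrite inE => /orP [/eqP ->|/IH [c ? ?]].
  by exists x; [left|].
by exists c; [right|].
Qed.

End Lists.

(** * Time limits *)

Section Limits.

(** A reversed comparison, with [None] as infinity: upper limits only go down, so this reads as an
    order in time. *)
Definition le_limit (o o' : option nat) : bool :=
  match o, o' with
  | Some m, Some m' => (m' <= m)%N | Some _, None => false | None, _ => true
  end.

Lemma le_limit_refl o : le_limit o o.
Proof. by case: o => /=. Qed.

Lemma le_limit_trans o1 o2 o3 : le_limit o1 o2 -> le_limit o2 o3 -> le_limit o1 o3.
Proof. by case: o1 o2 o3 => [?|] [?|] [?|] //= h1 h2; apply: leq_trans h1. Qed.

Lemma le_limit_some m o : le_limit (Some m) o -> exists2 m', o = Some m' & (m' <= m)%N.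
Proof. by case: o => //= m' h; exists m'. Qed.

Lemma le_min_limit o n : le_limit o (min_limit o n).
Proof. by case: o => //= m; rewrite geq_minl. Qed.

Lemma le_min_limit_r o n : le_limit (Some n) (min_limit o n).
Proof. by case: o => //= m; rewrite geq_minr. Qed.

Lemma le_foldl_min o l : le_limit o (foldl min_limit o l).
Proof.
elim: l o => [|n l IH] o /=; first exact: le_limit_refl.
exact: le_limit_trans (le_min_limit o n) (IH _).
Qed.

Lemma le_foldl_min_mem o l n : n \in l -> le_limit (Some n) (foldl min_limit o l).
Proof.
elim: l o => [|x l IH] o //=; rewrite inE => /orP [/eqP ->|]; last exact: IH.
exact: le_limit_trans (le_min_limit_r o x) (le_foldl_min _ _).
Qed.

Lemma le_foldl_max o l : (o <= foldl maxn o l)%N.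
Proof. elim: l o => [|n l IH] o //=; exact: leq_trans (leq_maxl o n) (IH _). Qed.

Lemma le_foldl_max_mem o l n : n \in l -> (n <= foldl maxn o l)%N.
Proof.
elim: l o => [|x l IH] o //=; rewrite inE => /orP [/eqP ->|]; last exact: IH.
exact: leq_trans (leq_maxr o x) (le_foldl_max _ _).
Qed.

End Limits.

(** * Version lists and the overwriting of the oldest version *)

Section Versions.
Variables (R : realDomainType) (V : Type).
Local Notation version := (version R V).
Implicit Types (vs : seq version) (v w : version) (i j : R).

Definition sorted_versions vs := sorted <%R (map (@ts R V) vs).

(* [j] is older than every version kept, hence may have been overwritten. *)
Definition lost j vs := forall v, In v vs -> j < ts v.

Lemma position_split vs i : exists A B,
  [/\ vs = A ++ B, position vs i = size A, forall v, In v A -> ts v < i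
    & if B is w :: _ then i <= ts w else True].
Proof.
elim: vs => [|v vs [A [B [-> E h hB]]]]; first by exists [::], [::].
rewrite /position /=; case: leP => iv; first by exists [::], (v :: A ++ B).
exists (v :: A), B; split=> //=; first by rewrite -E.
by move=> w [<-|/h].
Qed.

Lemma sorted_versions_cat A v B : sorted_versions (A ++ v :: B) ->
  (forall w, In w A -> ts w < ts v) /\ (forall w, In w B -> ts v < ts w).
Proof.
rewrite /sorted_versions sorted_pairwise; last exact: lt_trans.
rewrite map_cat pairwise_cat /= => /and3P [/allrelP a _ /andP [/allP b _]].
split=> w wi; last by apply: b; apply: In_map_mem.
by apply: a; rewrite ?mem_head //; apply: In_map_mem.
Qed.

Lemma find_versionP vs i c : sorted_versions vs -> find_version vs i = Some c ->
  exists A B, [/\ vs = A ++ c.1 :: B, position vs i = size (rcons A c.1),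
    c.2 = ohead B, ts c.1 < i & forall w, In w B -> i <= ts w].
Proof.
move=> srt; rewrite /find_version.
have [A [B [E pE h hB]]] := position_split vs i; rewrite {1}pE.
case/lastP: A E pE h => [|A v] E pE h //=; rewrite size_rcons.
have Ev : onth vs (size A) = Some v.
  by rewrite E cat_rcons onth_cat ltnn subnn.
rewrite Ev => - [<-] /=; exists A, B; split=> //.
- by rewrite E cat_rcons.
- rewrite -[LHS]/(onth vs (size A).+1) E onth_cat size_rcons ltnn subnn.
  by case: (B).
- by apply: h; apply/In_rcons; left.
case: B E pE hB Ev => [|b B] // E pE ib _ w [<- //|wB].
apply: le_trans ib _; apply/ltW.
by move: srt; rewrite E => /sorted_versions_cat [_]; apply.
Qed.

Lemma sorted_versions_drop vs n : sorted_versions vs -> sorted_versions (drop n vs).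
Proof.
by rewrite /sorted_versions map_drop; apply: drop_sorted.
Qed.

(* The version preceding the added one shields it from garbage collection. *)
Lemma sorted_versions_split A B v w : sorted_versions (A ++ B) ->
  In v A -> In w B -> ts v < ts w.
Proof.
rewrite /sorted_versions sorted_pairwise; last exact: lt_trans.
rewrite map_cat pairwise_cat => /andP [/allrelP h _] vA wB.
by apply: h; apply: In_map_mem.
Qed.

(** Overwriting removes a prefix of a sorted list, so a version that disappears is older than all
    those kept, the new one included. *)
Lemma add_versionP n vs v c : (0 < n)%N -> sorted_versions vs ->
  (size vs <= n)%N ->
  find_version vs (ts v) = Some c -> (forall w, In w vs -> ts w <> ts v) ->
  let vs' := add_version n vs v in
  [/\ sorted_versions vs', (size vs' <= n)%N, In v vs',
      forall w, In w vs' -> w = v \/ In w vs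
    & forall w, In w vs -> In w vs' \/ lost (ts w) vs'].
Proof.
move=> n0 srt sz fv new vs'.
have [A [B [E p _ cv hB]]] := find_versionP srt fv.
pose L := rcons A c.1 ++ v :: B.
have E' : vs = rcons A c.1 ++ B by rewrite E cat_rcons.
have EL : vs' = drop (size L - n) L.
  rewrite /vs' /add_version p E'.
  by rewrite (take_size_cat _ (erefl _)) (drop_size_cat _ (erefl (size (rcons A c.1)))).
have szL : size L = (size vs).+1 by rewrite /L E !size_cat /= size_rcons; lia.
have inL w : In w L <-> w = v \/ In w vs.
  rewrite /L E' !List.in_app_iff /=.
  by split; [case=> [?|[<-|?]]|case=> [->|[?|?]]]; auto 6.
have sL : sorted_versions L.
  move: (srt); rewrite {1}E => /sorted_versions_cat [hA _].
  move: srt; rewrite E -cat_rcons /sorted_versions /L.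
  rewrite !(sorted_pairwise lt_trans) !map_cat !pairwise_cat /=.
  case/and3P=> /allrelP h1 -> h2; rewrite h2 /= andbT; apply/andP; split.
    apply/allrelP => x y xA; rewrite inE => /orP [/eqP ->|]; last exact: h1.
    have [w wA <-] := mem_map_In xA.
    by case/In_rcons: wA => [->|/hA wc] //; apply: lt_trans cv.
  (* [find_version] bounds the later versions only weakly; [new] makes the bound strict. *)
  apply/allP => x /mem_map_In [w wB <-]; rewrite lt_neqAle hB // andbT.
  apply/eqP => /esym; apply: new; rewrite E List.in_app_iff /=; tauto.
(* At most one entry is dropped and [c.1] stands before [v], so the cut never reaches [v]. *)
have sd : (size L - n <= size (rcons A c.1))%N by rewrite size_rcons szL; lia.
split.
- by rewrite EL; apply: sorted_versions_drop.
- by rewrite EL size_drop; lia.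
- rewrite EL /L drop_cat; case: ltnP => h.
    by apply/List.in_app_iff; right; left.
  by rewrite (eqP (_ : _ - _ == 0)%N) ?drop0; [left|rewrite subn_eq0].
- by move=> w; rewrite EL => h; apply/inL; rewrite -(cat_take_drop (size L - n) L) List.in_app_iff; right.
move=> w wv; have /inL : w = v \/ In w vs by right.
rewrite -(cat_take_drop (size L - n) L) List.in_app_iff -EL => -[h|]; last by left.
right=> u; rewrite EL; apply: sorted_versions_split h.
by rewrite cat_take_drop.
Qed.

End Versions.

(** * Hash table, update list and validation *)

Section Operations.
Variables (R : realDomainType) (disp : Order.disp_t) (K : orderType disp).
Variables (V : Type) (M nversions incrVal : nat) (hash : K -> 'I_M).
Local Notation state := (state R K V M).
Local Notation version := (version R V).
Implicit Types (s : state) (i p q : R) (k : K).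
Implicit Types (col : seq (version * option version)).

(** [put_node] drops the nodes with its key and keeps all the others, so the table behaves as a map
    from keys to nodes. *)
Lemma find_put_node s nd k :
  find_node hash (put_node hash s nd) k =
    if k == nkey nd then Some nd else find_node hash s k.
Proof.
rewrite /find_node /=; have [->|ne] := eqVneq k (nkey nd).
  rewrite eqxx filter_cat /= eqxx -filter_predI.
  rewrite (eq_filter (a2 := pred0)) ?filter_pred0 // => m /=.
  by case: eqP => // ->; rewrite ltxx.
case: eqP => // hk; rewrite filter_cat /= eq_sym (negbTE ne) -!filter_predI hk.
have [kn|] := ltP k (nkey nd); last first.
  rewrite le_eqVlt eq_sym (negbTE ne) /= => nk.
  rewrite (eq_filter (a2 := pred0)) ?filter_pred0 => [|m /=]; last first.
    by case: eqP => // ->; rewrite lt_gtF.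
  by congr ohead; apply: eq_filter => m /=; case: eqP => // ->.
rewrite [X in _ ++ X](eq_filter (a2 := pred0)) ?filter_pred0 => [|m /=]; last first.
  by case: eqP => // ->; rewrite lt_gtF.
by rewrite cats0; congr ohead; apply: eq_filter => m /=; case: eqP => // ->.
Qed.

Definition entry (T : Type) (l : seq (K * T)) k : option (K * T) :=
  ohead [seq u <- l | u.1 == k].

Lemma entry_None (T : Type) (l : seq (K * T)) k :
  k \notin map fst l -> entry l k = None.
Proof.
rewrite /entry; elim: l => [|x l IH] //=; rewrite inE negb_or eq_sym.
by case/andP=> /negbTE -> /IH.
Qed.

Lemma apply_updates_tx i us s : let s' := foldl (apply_update nversions hash i) s us in
  [/\ tx s' = tx s, begun s' = begun s & gcounter s' = gcounter s].
Proof. by elim: us s => [|u us IH] s //=; case: (IH (apply_update nversions hash i s u)). Qed.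

(** With distinct keys the updates of a tryC do not interact: each acts on the version list found
    before the first of them. *)
Lemma find_apply_updates i us s k : uniq (map fst us) ->
  find_node hash (foldl (apply_update nversions hash i) s us) k =
  if entry us k is Some u then
    let vs := if find_node hash s k is Some nd then vl nd
              else [:: initial_version V i] in
    Some (Node k (~~ isSome u.2)
      (add_version nversions vs (Version i u.2 [::] (tltl (tx s i)))))
  else find_node hash s k.
Proof.
elim: us s => [|u us IH] s //= /andP [nin un]; rewrite IH //.
have [E|ne] := eqVneq u.1 k.
  rewrite {1}/entry /= -/(entry us k) entry_None -?E //= find_put_node /= eqxx.
  by rewrite /entry /= eqxx.
have -> : entry (u :: us) k = entry us k by rewrite /entry /= (negbTE ne).
by case: (entry us k) => [w|]; rewrite find_put_node /= eq_sym (negbTE ne).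
Qed.

Lemma updates_uniq s i : uniq (map fst (log (tx s i))) -> uniq (map fst (updates s i)).
Proof.
move=> u; rewrite /updates.
set l := [seq _ | x <- _ & _].
have -> : map fst (sort (fun x y => (x.1 <= y.1)%O) l) = sort <=%O (map fst l).
  exact: esym (sort_map l).
rewrite sort_uniq /l -map_comp; move: u.
elim: (log _) => [|x lg IH] //= /andP [nin /IH h]; case: ifP => //= _.
rewrite h andbT; apply: contra nin.
elim: {IH h} lg => [|y lg IH] //=; rewrite inE; case: ifP => _ /=; last first.
  by move=> /IH ->; rewrite orbT.
by rewrite inE => /orP [->|/IH ->]; rewrite ?orbT.
Qed.

Lemma entry_updates s i k : uniq (map fst (log (tx s i))) ->
  entry (updates s i) k =
    if logged s i k is Some (w, true) then Some (k, w) else None.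
Proof.
rewrite /entry /updates filter_sort; last 2 first.
- by move=> x y; apply: le_total.
- by move=> x y z; apply: le_trans.
rewrite /logged; elim: (log _) => [|[k' [w u]] lg IH] //= /andP [nin ul].
have [E|ne] := eqVneq k' k; last first.
  by case: u => /=; rewrite ?(negbTE ne) IH.
have nil : [seq x <- [seq (x.1, x.2.1) | x <- lg & x.2.2] | x.1 == k] = [::].
  move: nin; rewrite E; elim: (lg) => [|x l IHl] //=; rewrite inE negb_or eq_sym.
  by case/andP=> nx /IHl {}IHl; case: ifP => //= _; rewrite (negbTE nx).
by case: u => /=; rewrite ?E ?eqxx nil.
Qed.

Lemma entry_In (T : Type) (l : seq (K * T)) k u : entry l k = Some u -> k \in map fst l.
Proof.
rewrite /entry; elim: l => [|x l IH] //=; rewrite inE eq_sym.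
by case: eqP => //= _ /IH.
Qed.

(** The frame of a validation, including a failed one: tightened limits, the advanced counter and
    readers aborted by earlier checks survive the failure. A read that aborts after tightening its
    limits satisfies it too. *)
Record limits_step s s' i : Prop := LimitsStep {
  ls_table : table s' = table s;
  ls_begun : begun s' = begun s;
  ls_gcounter : (gcounter s <= gcounter s')%N;
  ls_its p : its (tx s' p) = its (tx s p);
  ls_log p : log (tx s' p) = log (tx s p);
  ls_closed p : Defs.closed (tx s' p) = Defs.closed (tx s p);
  ls_tltl p : (tltl (tx s p) <= tltl (tx s' p))%N;
  ls_tutl p : le_limit (tutl (tx s p)) (tutl (tx s' p));
  ls_stat_self : stat (tx s' i) = stat (tx s i);
  ls_stat p : stat (tx s' p) = stat (tx s p) \/
              stat (tx s p) = Live /\ stat (tx s' p) = StFalse }.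

Lemma limits_step_refl s i : limits_step s s i.
Proof. by split=> // p; [apply: le_limit_refl|left]. Qed.

Lemma limits_step_trans s1 s2 s3 i :
  limits_step s1 s2 i -> limits_step s2 s3 i -> limits_step s1 s3 i.
Proof.
case=> [a1 a2 a3 a4 a5 a6 a7 a8 a9 a10] [b1 b2 b3 b4 b5 b6 b7 b8 b9 b10]; split.
- by rewrite b1.
- by rewrite b2.
- exact: leq_trans a3 b3.
- by move=> p; rewrite b4.
- by move=> p; rewrite b5.
- by move=> p; rewrite b6.
- by move=> p; apply: leq_trans (a7 p) (b7 p).
- by move=> p; apply: le_limit_trans (a8 p) (b8 p).
- by rewrite b9.
move=> p; case: (a10 p) (b10 p) => [E|[E1 E2]] [F|[F1 F2]].
- by left; rewrite F.
- by right; rewrite -E.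
- by right; rewrite F.
- by rewrite E2 in F1.
Qed.

(** [h] is the time chosen by a successful check, which becomes the [vrt] of the new versions.
    Readers are described in the final state [s'], since the bounds on the smaller ones hold only if
    the check has not aborted them. *)
Record checked s i col s' h : Prop := Checked {
  ck_tltl : tltl (tx s' i) = h;
  ck_gcounter : (h <= gcounter s')%N;
  ck_tutl : le_limit (tutl (tx s i)) (Some h);
  ck_lo : (tltl (tx s i) <= h)%N;
  ck_prev c : In c col -> (vrt c.1 < h)%N;
  ck_next c w : In c col -> c.2 = Some w -> (h <= (vrt w).-1)%N;
  ck_large c p : In c col -> p \in rvl c.1 -> i < p -> stat (tx s' p) = StFalse;
  ck_small c p : In c col -> p \in rvl c.1 -> p < i -> stat (tx s' p) <> StFalse ->
    (tltl (tx s' p) <= h)%N /\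
    (stat (tx s' p) = Live -> le_limit (Some h.-1) (tutl (tx s' p))) }.

Lemma checkP s i col s' b : check incrVal s i col = (s', b) ->
  limits_step s s' i /\ (b -> exists h, checked s i col s' h).
Proof.
rewrite /check.
set all_r := flatten _; set large := [seq p <- _ | i < p]; set small := [seq p <- _ | p < i].
set can := fun p => _.
case: ifP => _; first by case=> <- <-; split=> //; apply: limits_step_refl.
case: ifP => [_|/negbFE can_large]; first by case=> <- <-; split=> //; apply: limits_step_refl.
set hi0 := foldl min_limit _ _; set lo := foldl maxn _ _.
set com := (_ + _)%N; set hi := (if hi0 is Some m then _ else _).
have hi_com : (hi <= com)%N by rewrite /hi; case: (hi0) => // m; apply: geq_minr.
have hi_hi0 : le_limit hi0 (Some hi) by rewrite /hi; case: (hi0) => //= m; rewrite geq_minl.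
have lo_t : (tltl (tx s i) <= lo)%N by apply: le_foldl_max.
have hi_t : le_limit (tutl (tx s i)) (Some hi).
  exact: le_limit_trans (le_foldl_min _ _) hi_hi0.
(* The state left by a check that fails after its limits have been computed. *)
have step1 : limits_step s (State com (table s) (begun s)
   (fun j => if j == i then set_limits (tx s i) lo (Some hi) else tx s j)) i.
  split=> //=; rewrite ?eqxx ?leq_addr //.
  - by move=> p; case: eqP => // ->.
  - by move=> p; case: eqP => // ->.
  - by move=> p; case: eqP => // ->.
  - by move=> p; case: eqP => // ->.
  - by move=> p; case: eqP => [-> //|_]; apply: le_limit_refl.
  - by move=> p; left; case: eqP => // ->.
case: ltnP => [_|lohi]; first by case=> <- <-.
set late := [seq p <- small | _].
case: ifP => [_|/negbFE can_late]; first by case=> <- <-.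
(* Everything in [abortRVL] is live, so a committed transaction never loses its status. *)
have canP p : p \in large ++ late -> stat (tx s p) = Live.
  rewrite mem_cat => /orP [/(allP can_large)|/(allP can_late)]; rewrite /can /is_live;
    by case/andP=> _; case: (stat _).
set upd := fun p => _.
case=> <- <-; split=> [|_]; first split=> //=; rewrite ?leq_addr //.
- move=> p; rewrite /upd; case: eqP => [-> //|_]; by do 2!case: ifP => _ //.
- move=> p; rewrite /upd; case: eqP => [-> //|_]; by do 2!case: ifP => _ //.
- move=> p; rewrite /upd; case: eqP => [-> //|_]; by do 2!case: ifP => _ //.
- move=> p; rewrite /upd; case: eqP => [->|_]; last by do 2!case: ifP => _ //.
  exact: leq_trans lo_t lohi.
- move=> p; rewrite /upd; case: eqP => [-> //|_].
  by do 2!case: ifP => _ //=; rewrite ?le_min_limit // le_limit_refl.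
- by rewrite /upd eqxx.
- move=> p; rewrite /upd; case: eqP => [->|_]; first by left.
  case: ifP => [/canP ->|_]; first by right.
  by left; case: ifP.
have hi_next c w : In c col -> c.2 = Some w -> (hi <= (vrt w).-1)%N.
  move=> cc cw.
  have : (vrt w).-1 \in [seq (vrt w).-1 | w <- pmap snd col].
    elim: (col) cc => [|x l IHl] //= [->|/IHl h]; first by rewrite cw /= inE eqxx.
    by case: (x.2) => //= ?; rewrite inE h orbT.
  move/(le_foldl_min_mem (tutl (tx s i))) => h.
  exact: le_limit_trans h hi_hi0.
exists hi; split=> //=.
- by rewrite /upd eqxx.
- exact: leq_trans lo_t lohi.
- move=> c cc; apply: leq_trans lohi; apply: le_foldl_max_mem.
  exact: (In_map_mem (fun c => (vrt c.1).+1)).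
- move=> c p cc pc ip; rewrite /upd ifN ?gt_eqF //.
  by rewrite mem_cat mem_filter ip (In_flatten_map (f := fun c => rvl c.1) cc pc).
move=> c p cc pc pi_; rewrite /upd lt_eqF //.
have ps : p \in small.
  by rewrite mem_filter pi_ (In_flatten_map (f := fun c => rvl c.1) cc pc).
case: ifP => //= /negbT; rewrite mem_cat negb_or => /andP [_].
rewrite mem_filter ps andbT -leqNgt /= => le_p; rewrite /is_live.
case E: (stat (tx s p)) => //=; rewrite ?E //.
by split=> // _; apply: le_min_limit_r.
Qed.

(** In both modes the last check runs on the complete list of collected versions, so a single
    [checked] covers all the update keys. Without update keys no check is run at all. *)
Lemma validateP each_key s i col ks s' :
  validate incrVal hash each_key s i col ks = (s', true) ->
  limits_step s s' i /\
  (ks <> [::] -> exists col' h, [/\ exists s0, limits_step s s0 i /\ checked s0 i col' s' h,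
     forall c, In c col -> In c col' &
     forall k nd, k \in ks -> find_node hash s k = Some nd ->
       exists2 c, find_version (vl nd) i = Some c & In c col']).
Proof.
elim: ks s col => [|k ks IH] s col /=.
  by case=> <-; split=> //; apply: limits_step_refl.
have main col1 : 
  (if each_key || nilp ks then
     let: (s1, ok) := check incrVal s i col1 in
     if ok then validate incrVal hash each_key s1 i col1 ks else (s1, false)
   else validate incrVal hash each_key s i col1 ks) = (s', true) ->
  limits_step s s' i /\
  exists col' h, [/\ exists s0, limits_step s s0 i /\ checked s0 i col' s' h,
     forall c, In c col1 -> In c col' &
     forall k nd, k \in ks -> find_node hash s k = Some nd ->
       exists2 c, find_version (vl nd) i = Some c & In c col'].
  case: ifP => [_|]; last first.
    move/norP => [_ nn] /IH [st /(_ _) post]; split=> //; apply: post.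
    by move=> E; rewrite E in nn.
  case E: (check _ _ _ _) => [s1 []] // /[dup] v /IH [st post].
  have [st1 /(_ isT) [h ck]] := checkP E.
  split; first exact: limits_step_trans st1 st.
  case: ks v post {IH} => [|k1 ks] v post.
    case: v => <-; exists col1, h; split=> //; by exists s; split=> //; apply: limits_step_refl.
  have [//|col' [h' [[s0 [st0 ck0]] sub fk]]] := post _.
  exists col', h'; split=> //.
    by exists s0; split=> //; apply: limits_step_trans st1 st0.
  by move=> k2 nd k2in fn; apply: (fk k2) => //; rewrite /find_node (ls_table st1).
case fn: (find_node hash s k) => [nd|].
  case fv: (find_version (vl nd) i) => [c|] // /main [st [col' [h [x1 x2 x3]]]].
  split=> // _; exists col', h; split=> // [d dc|k1 nd1].
    by apply: x2; apply/In_rcons; right.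
  rewrite inE => /orP [/eqP ->|]; last exact: x3.
  by rewrite fn => - [<-]; exists c => //; apply: x2; apply/In_rcons; left.
case/main => st [col' [h [x1 x2 x3]]]; split=> // _; exists col', h; split=> //.
by move=> k1 nd1; rewrite inE => /orP [/eqP ->|]; [rewrite fn|exact: x3].
Qed.

Lemma validate_step each_key s i col ks s' b :
  validate incrVal hash each_key s i col ks = (s', b) -> limits_step s s' i.
Proof.
elim: ks s col => [|k ks IH] s col /=.
  by case=> <- _; apply: limits_step_refl.
have main col1 : 
  (if each_key || nilp ks then
     let: (s1, ok) := check incrVal s i col1 in
     if ok then validate incrVal hash each_key s1 i col1 ks else (s1, false)
   else validate incrVal hash each_key s i col1 ks) = (s', b) ->
  limits_step s s' i.
  case: ifP => [_|_ /IH //].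
  case E: (check _ _ _ _) => [s1 []]; have [st1 _] := checkP E.
    by move/IH; apply: limits_step_trans.
  by case=> <- _.
case: (find_node hash s k) => [nd|]; last exact: main.
case: (find_version (vl nd) i) => [c|]; first exact: main.
by case=> <- _; apply: limits_step_refl.
Qed.

End Operations.

(** * Invariants of executions *)

Section Protocol.
Variables (R : realDomainType) (disp : Order.disp_t) (K : orderType disp).
Variables (V : Type) (M nversions : nat) (hash : K -> 'I_M).
Local Notation state := (state R K V M).
Local Notation version := (version R V).
Local Notation event := (event R K V).
Local Notation txns := (map (@txn R K V)).
Local Notation find_node := (find_node hash).
Local Notation closed := Defs.closed.
Implicit Types (s : state) (i j p q : R) (k : K) (x e : event) (H : seq event).
Implicit Types (sg kp : R -> nat) (rd : R -> K -> option R).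

Definition succeeds q e := (txn e == q) && ~~ aborts e.
Definition sees H q i := before (tryC_commits i) (succeeds q) H.
Definition ends_before H i j :=
  before (fun e => (txn e == i) && terminates e) (begins j) H.
Definition writer H k i := has (tryC_commits i) H && isSome (written i k H).
Definition value_of H k j (r : option V) : Prop :=
  (j = 0 /\ r = None) \/ (has (tryC_commits j) H /\ written j k H = Some r).

Definition klt sg kp i j := (sg i < sg j)%N || ((sg i == sg j) && (kp i < kp j)%N).

Definition updated (w : option (option V * bool)) : option (option V) :=
  if w is Some (v, true) then Some v else None.

(** The sequential half of the invariant, tying logs to histories. It depends on [H] through
    projections only, hence survives [place]. By [pi_accessed] a key read from the shared memory is
    in the log from then on and is not read there again, so [rd] can be a function. *)
Record program_inv s H rd : Prop := ProgramInv {
  pi_begun i : (i \in begun s) = (i \in txns H);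
  pi_begin i : i \in txns H -> exists B, proj i H = Begin i :: B;
  pi_last i B e Q : proj i H = B ++ e :: Q -> terminates e -> Q = [::];
  pi_closed i : i \in begun s ->
    closed (tx s i) = has (@terminates R K V) (proj i H);
  pi_stat i : stat (tx s i) = Committed <-> has (tryC_commits i) H;
  pi_uniq i : uniq (map fst (log (tx s i)));
  pi_view i k : own_view i k H = omap fst (logged s i k);
  pi_written i k : written i k H = updated (logged s i k);
  pi_read q B e Q k r : proj q H = B ++ e :: Q -> returns e = Some (q, k, r) ->
    if own_view q k B is Some r' then r = r'
    else exists2 j, rd q k = Some j & value_of H k j r;
  pi_accessed q k j : rd q k = Some j -> own_view q k H <> None }.

Section Extend.
Variables (H H' : seq event) (x : event).
Hypothesis ext : forall i, proj i H' = proj i (rcons H x).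

Lemma ext_view i k : own_view i k H' = view_step i k (own_view i k H) x.
Proof. by rewrite -own_view_proj ext own_view_proj own_view_rcons. Qed.

Lemma ext_written i k : written i k H' = write_step i k (written i k H) x.
Proof. by rewrite -written_proj ext written_proj written_rcons. Qed.

Lemma ext_tryC i : has (tryC_commits i) H' = tryC_commits i x || has (tryC_commits i) H.
Proof.
rewrite -(has_proj _ (@tryC_commits_txn _ _ _ i)) ext has_proj ?has_rcons //.
exact: tryC_commits_txn.
Qed.

Lemma ext_txns i : (i \in txns H') = (i == txn x) || (i \in txns H).
Proof. by rewrite mem_txn_proj ext -mem_txn_proj map_rcons mem_rcons inE. Qed.

End Extend.

Lemma committed_begun s H rd i : program_inv s H rd ->
  has (tryC_commits i) H -> i \in begun s.
Proof.
move=> inv h; rewrite (pi_begun inv) mem_txn; apply: sub_has h => e /tryC_commits_txn ->.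
exact: eqxx.
Qed.

Lemma committed_closed s H rd i : program_inv s H rd ->
  has (tryC_commits i) H -> closed (tx s i).
Proof.
move=> inv h; rewrite (pi_closed inv) ?(committed_begun inv h) //.
rewrite -(has_proj _ (@tryC_commits_txn _ _ _ i)) in h.
apply: sub_has h; exact: tryC_commits_terminates.
Qed.

(** Shared by all the methods. Of the other transactions it asks only that logs, closure and the
    fact of being committed are kept, so their limits may move and they may be aborted. *)
Lemma program_inv_step s H rd s' H' rd' x (i := txn x) :
  program_inv s H rd ->
  (forall j, proj j H' = proj j (rcons H x)) ->
  begun s' = (if begins i x then i :: begun s else begun s) ->
  (if begins i x then i \notin begun s else (i \in begun s) && ~~ closed (tx s i)) ->
  (forall p, p != i -> [/\ log (tx s' p) = log (tx s p), closed (tx s' p) = closed (tx s p)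
      & stat (tx s' p) = Committed <-> stat (tx s p) = Committed]) ->
  closed (tx s' i) = terminates x ->
  (stat (tx s' i) = Committed <-> tryC_commits i x) ->
  uniq (map fst (log (tx s' i))) ->
  (forall k, omap fst (logged s' i k) = view_step i k (omap fst (logged s i k)) x) ->
  (forall k, updated (logged s' i k) = write_step i k (updated (logged s i k)) x) ->
  (forall q k j, rd q k = Some j -> rd' q k = Some j) ->
  (forall k r, returns x = Some (i, k, r) ->
     if logged s i k is Some (w, _) then r = w
     else exists2 j, rd' i k = Some j & value_of H' k j r) ->
  (forall q k j, rd' q k = Some j ->
     rd q k = Some j \/ q = i /\ logged s' i k <> None) ->
  program_inv s' H' rd'.
Proof.
move=> inv ext c1 c2 c3 c4 c5 c6 c7 c7' c8 c9 c10.
have nterm : ~~ has (@terminates R K V) (proj i H).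
  move: c2; case: ifP => _.
    by rewrite (pi_begun inv) => ni; rewrite proj_nil.
  by case/andP=> ib; rewrite (pi_closed inv).
have ncom : ~~ has (tryC_commits i) H.
  apply: contra nterm; rewrite -(has_proj _ (@tryC_commits_txn _ _ _ i)).
  apply: sub_has; exact: tryC_commits_terminates.
have vmono k j r : value_of H k j r -> value_of H' k j r.
  case=> [?|[cj wj]]; [by left|right]; rewrite (ext_tryC ext) cj orbT.
  rewrite (ext_written ext) write_step_other //.
  by apply: contraTneq cj => <-.
have lg p k : p != i -> logged s' p k = logged s p k.
  by move=> /c3 [E _ _]; rewrite /logged E.
have view_some q k : own_view q k H <> None -> own_view q k H' <> None.
  rewrite (ext_view ext); case: (own_view q k H) => // w _.
  by case: (x) => //= [? ? []|? ? []|? ? ?] // *; case: ifP.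
split.
- move=> j; rewrite (ext_txns ext) -/i c1 -(pi_begun inv).
  move: c2; case: ifP => _; first by rewrite inE.
  by case/andP=> ib _; case: eqP => // ->.
- move=> j; rewrite (ext_txns ext) ext proj_rcons -/i (eq_sym i); case: (eqVneq j i) => [-> _|_ /=]; last exact: (pi_begin inv).
  case: ifP c2 => [b|_]; rewrite (pi_begun inv).
    by move/proj_nil ->; exists [::]; move: b; case: (x) => //= l /eqP ->.
  by case/andP=> /(pi_begin inv) [B ->] _; exists (rcons B x).
- move=> j B e Q; rewrite ext proj_rcons -/i; case: (eqVneq i j) => [<-|_]; last exact: (pi_last inv).
  move=> E te; have [[_ _ ->]//|[B3 E3]] := rcons_eq_split E.
  by case/negP: nterm; rewrite E3 has_cat /= te orbT.
- move=> j; have [->|ne] := eqVneq j i => jb.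
    by rewrite ext proj_rcons -/i eqxx has_rcons (negbTE nterm) orbF c4.
  have [_ -> _] := c3 _ ne.
  rewrite ext proj_rcons -/i eq_sym (negbTE ne) (pi_closed inv) //.
  by move: jb; rewrite c1; case: ifP => // _; rewrite inE (negbTE ne).
- move=> j; rewrite (ext_tryC ext); have [->|ne] := eqVneq j i.
    by rewrite (negbTE ncom) orbF.
  have [_ _ ->] := c3 _ ne; rewrite (pi_stat inv).
  have -> : tryC_commits j x = false by apply: contraNF ne => /tryC_commits_txn <-.
  by [].
- by move=> j; have [->|/c3 [->]] := eqVneq j i => //; rewrite (pi_uniq inv).
- move=> j k; rewrite (ext_view ext) (pi_view inv); have [->|ne] := eqVneq j i => //.
  by rewrite lg // view_step_other // eq_sym.
- move=> j k; rewrite (ext_written ext) (pi_written inv); have [->|ne] := eqVneq j i => //.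
  by rewrite lg // write_step_other // eq_sym.
- move=> q B e Q k r; rewrite ext proj_rcons -/i => E re.
  have old : forall Q', proj q H = B ++ e :: Q' -> if own_view q k B is Some r' then r = r'
      else exists2 j, rd' q k = Some j & value_of H' k j r.
    move=> Q' E'; have := pi_read inv E' re; case: (own_view q k B) => // -[j /c8 ? /vmono ?].
    by exists j.
  move: E; case: eqP => [Eq|_]; last exact: old.
  move=> E; have [[EB Ee _]|[B3 /old //]] := rcons_eq_split E.
  rewrite -EB own_view_proj (pi_view inv) -Eq.
  have := c9 k r; rewrite Ee Eq => /(_ re).
  by case: (logged s q k) => [[w u]|].
move=> q k j /c10 [/(pi_accessed inv)/view_some //|[-> nl]].
rewrite (ext_view ext) (pi_view inv) -c7.
by case: (logged s' i k) nl.
Qed.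

Lemma fresh_logged s H rd i k : program_inv s H rd -> i \notin begun s -> logged s i k = None.
Proof.
move=> inv ni; have := pi_view inv i k; rewrite -own_view_proj proj_nil -?(pi_begun inv) //=.
by case: (logged s i k).
Qed.

(** Overwriting loses versions and their readers, so the last two clauses hold up to [lost], which
    still places the missing timestamp below every version kept. *)
Definition versions_inv H sg rd k (vs : seq version) : Prop :=
  [/\ sorted_versions vs, (size vs <= nversions)%N,
      forall v, In v vs ->
        (ts v = 0 /\ vval v = None /\ vrt v = 0%N) \/
        [/\ has (tryC_commits (ts v)) H, written (ts v) k H = Some (vval v)
          & vrt v = sg (ts v)],
      forall i, writer H k i -> (exists2 v, In v vs & ts v = i) \/ lost i vs
    & forall q j, rd q k = Some j ->
        (exists v, [/\ In v vs, ts v = j & q \in rvl v]) \/ lost j vs].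

Definition node_inv s H sg rd k : Prop :=
  if find_node s k is Some nd then
    versions_inv H sg rd k (vl nd)
  else (forall i, ~~ writer H k i) /\ (forall q, rd q k = None).

(* [rd q k] is the timestamp of the version of [k] that T_q has read from the
   shared memory.  In [oi_vis], once the status of T_q is false only the commits
   that precede its last successful event count: T_i may well overwrite what it
   aborts. *)
Record order_inv s H sg kp clk rd : Prop := OrderInv {
  oi_gcounter : (0 < gcounter s)%N;
  oi_pos i : i \in begun s -> 0 < i;
  oi_its i : i \in begun s -> (its (tx s i) <= gcounter s)%N;
  oi_sg i : i \in begun s -> [/\ (0 < sg i)%N, (sg i <= gcounter s)%N & (sg i <= tltl (tx s i))%N];
  oi_kp i : i \in begun s -> (kp i < clk)%N;
  oi_inj : {in begun s &, injective kp};
  oi_rt i j : ends_before H i j -> klt sg kp i j;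
  oi_node k : node_inv s H sg rd k;
  oi_ww k i j : writer H k i -> writer H k j -> i < j -> (sg i < sg j)%N;
  oi_rd q k j : rd q k = Some j -> [/\ q \in begun s, j < q & j = 0 \/
     [/\ has (tryC_commits j) H, klt sg kp j q, sees H q j & (sg j < tltl (tx s q))%N]];
  oi_tutl q k j i : stat (tx s q) = Live -> rd q k = Some j -> writer H k i -> q < i ->
    exists2 m, tutl (tx s q) = Some m & (m < sg i)%N;
  oi_vis q k j i : rd q k = Some j -> writer H k i -> i <> q ->
    stat (tx s q) <> StFalse \/ sees H q i ->
    (i < q -> i <= j) /\ (q < i -> klt sg kp q i) }.

Definition extends H x H' : Prop :=
  H' = rcons H x \/ (H' = place x H /\ ~~ terminates x).

Lemma extends_proj H x H' : extends H x H' -> forall i, proj i H' = proj i (rcons H x).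
Proof. by case=> [->|[-> _]] i; rewrite ?proj_place. Qed.

(** * Adding an event of an open transaction *)

Section ExtendsOpen.
Variables (s : state) (H H' : seq event) (rd : R -> K -> option R) (x : event).
Hypothesis inv : program_inv s H rd.
Hypothesis ext : extends H x H'.
Hypothesis open : (txn x \in begun s) && ~~ closed (tx s (txn x)).

Lemma open_terminates : all (fun y => (txn y == txn x) ==> ~~ terminates y) H.
Proof.
case/andP: open => xb; rewrite (pi_closed inv) // has_in_proj -all_predC.
by apply: sub_all => y /=; rewrite negb_and -implybE.
Qed.

Lemma open_uncommitted : ~~ has (tryC_commits (txn x)) H.
Proof. by case/andP: open => _; apply: contra => /(committed_closed inv). Qed.

(** Both [sees] and [ends_before] have a terminating event on the left, and an open transaction has
    none: an inserted event cannot become the earlier witness. *)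
Lemma open_place (a b : pred event) : ~~ a x -> (forall y, a y -> terminates y) ->
  (b x -> forall y, txn y = txn x -> ~~ terminates y -> b y) ->
  before a b (place x H) = before a b H.
Proof.
move=> ax at_ bx; apply: before_place => //.
- apply: sub_all open_terminates => y /implyP h; apply/implyP => /h.
  by apply: contra => /at_.
- move=> /bx {}bx; apply: sub_all open_terminates => y /implyP h; apply/implyP => /[dup] /eqP yx /h.
  exact: bx.
- by rewrite -(pi_begun inv); case/andP: open.
Qed.

(** A method served by the log is linearised with an earlier success of its transaction, so it makes
    no further commit visible. *)
Lemma extends_sees_place q i : ~~ terminates x -> sees (place x H) q i = sees H q i.
Proof.
move=> nt; apply: open_place.
- by apply: contra nt; apply: tryC_commits_terminates.
- exact: tryC_commits_terminates.
- move=> /andP [/eqP xq _] y yx; rewrite /succeeds yx xq eqxx /=.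
  by apply: contra; rewrite /terminates => ->.
Qed.

Lemma extends_sees q i : sees H q i -> sees H' q i.
Proof.
move=> h; case: ext => [->|[-> nt]]; last by rewrite extends_sees_place.
by rewrite /sees before_rcons -/(sees H q i) h.
Qed.

Lemma extends_sees_inv q i : sees H' q i ->
  sees H q i \/ (q = txn x /\ ~~ aborts x).
Proof.
case: ext => [->|[-> nt]]; last by rewrite extends_sees_place //; left.
rewrite /sees before_rcons => /orP [|/andP [_ /andP [/eqP <- ?]]]; first by left.
by right.
Qed.

Lemma extends_ends i j : ~~ begins j x -> ends_before H' i j -> ends_before H i j.
Proof.
move=> nb; case: ext => [->|[-> nt]].
  by rewrite /ends_before before_rcons (negbTE nb) andbF orbF.
rewrite /ends_before open_place //=.
- by rewrite negb_and nt orbT.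
- by move=> y /andP [].
by move=> b; rewrite b in nb.
Qed.

Lemma extends_committed_written i k : has (tryC_commits i) H ->
  written i k H' = written i k H.
Proof.
move=> ci; rewrite (ext_written (extends_proj ext)) write_step_other //.
by apply: contraNneq open_uncommitted => ->.
Qed.

Lemma extends_writer k i : ~~ tryC_commits (txn x) x || ~~ isSome (written (txn x) k H) ->
  writer H' k i = writer H k i.
Proof.
move=> h; rewrite /writer (ext_tryC (extends_proj ext)).
have [ci|nci] := boolP (has (tryC_commits i) H).
  by rewrite orbT extends_committed_written.
rewrite orbF /=; case cx: (tryC_commits i x) => //=.
have E := tryC_commits_txn cx; rewrite E cx /= in h.
rewrite (ext_written (extends_proj ext)); move: cx; case: (x) => //= j b.
by rewrite (negbTE h).
Qed.

(** For steps that leave all the keys alone: log answers, aborts, commits without updates. The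
    three-way hypothesis keeps a transaction of status false from seeing new commits, about which
    [oi_vis] promises nothing for it. *)
Lemma order_inv_quiet s' sg kp clk :
  order_inv s H sg kp clk rd ->
  ~~ begins (txn x) x ->
  (forall k, ~~ tryC_commits (txn x) x || ~~ isSome (written (txn x) k H)) ->
  [\/ aborts x, stat (tx s (txn x)) <> StFalse | H' = place x H /\ ~~ terminates x] ->
  table s' = table s -> begun s' = begun s -> (gcounter s <= gcounter s')%N ->
  (forall p, (tltl (tx s p) <= tltl (tx s' p))%N /\ its (tx s' p) = its (tx s p)) ->
  (forall p, stat (tx s' p) = Live -> stat (tx s p) = Live /\
      le_limit (tutl (tx s p)) (tutl (tx s' p))) ->
  (forall p, stat (tx s' p) <> StFalse -> stat (tx s p) <> StFalse) ->
  order_inv s' H' sg kp clk rd.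
Proof.
move=> oi nb nw ab tab beg gc tl lv nf.
have wr k i : writer H' k i = writer H k i by apply: extends_writer.
have cm i : has (tryC_commits i) H -> has (tryC_commits i) H'.
  by rewrite (ext_tryC (extends_proj ext)) => ->; rewrite orbT.
split.
- exact: leq_trans (oi_gcounter oi) gc.
- by rewrite beg; apply: oi_pos oi.
- by move=> i; rewrite beg => ib; have [_ ->] := tl i; apply: leq_trans gc; apply: (oi_its oi).
- move=> i; rewrite beg => ib; have [a b c] := oi_sg oi ib; have [d _] := tl i.
  by split; lia.
- by rewrite beg; apply: oi_kp oi.
- by rewrite beg; apply: oi_inj oi.
- move=> i j /extends_ends h; apply: (oi_rt oi); apply: h.
  by apply: contra nb => b; rewrite (begins_txn b).
- move=> k; have := oi_node oi k; rewrite /node_inv.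
  have -> : find_node s' k = find_node s k by rewrite /Defs.find_node tab.
  case: (find_node s k) => [nd|] [].
    move=> h1 h2 h3 h4 h5; split=> // [v /h3 [?|[a b c]]|i]; last by rewrite wr; apply: h4.
      by left.
    by right; split=> //; [apply: cm|rewrite extends_committed_written].
  by move=> h1 h2; split=> // i; rewrite wr.
- by move=> k i j; rewrite !wr => h1 h2 h3; apply: (oi_ww oi h1 h2 h3).
- move=> q k j /(oi_rd oi) [h1 h2 h3]; rewrite beg; split=> //.
  case: h3 => [?|[a b c d]]; [by left|right]; split=> //; [exact: cm|exact: extends_sees|].
  by have [e _] := tl q; lia.
- move=> q k j i /lv [l lim] h1; rewrite wr => h2 h3.
  have [m E lt] := oi_tutl oi l h1 h2 h3.
  rewrite E in lim; have [m' E' lt'] := le_limit_some lim.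
  by exists m' => //; lia.
- move=> q k j i h1; rewrite wr => h2 h3 h4; apply: (oi_vis oi h1 h2 h3).
  case: h4 => [/nf ?|h4]; [by left|].
  case: ab => [a|ns|[E nt]]; last by right; rewrite E extends_sees_place in h4.
    by case/extends_sees_inv: h4 => [?|[_ nab]]; [right|rewrite a in nab].
  by case/extends_sees_inv: h4 => [?|[-> _]]; [right|left].
Qed.

End ExtendsOpen.

(** The clock value is fresh, so a raised key stays above all it was above, even when its first
    component does not move. *)
Lemma lexi_raise a b ka kb n clk :
  (a < b)%N || ((a == b) && (ka < kb)%N) -> (b <= n)%N -> (kb < clk)%N ->
  (a < n)%N || ((a == n) && (ka < clk)%N).
Proof. lia. Qed.

Lemma lexi_le a n ka clk : (a <= n)%N -> (ka < clk)%N ->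
  (a < n)%N || ((a == n) && (ka < clk)%N).
Proof. lia. Qed.

Definition upd (f : R -> nat) i n := fun p => if p == i then n else f p.

Lemma upd_self f i n : upd f i n i = n.
Proof. by rewrite /upd eqxx. Qed.

Lemma upd_other f i n p : p != i -> upd f i n p = f p.
Proof. by rewrite /upd => /negbTE ->. Qed.

Lemma writer_committed H k i : writer H k i -> has (tryC_commits i) H.
Proof. by case/andP. Qed.

Lemma committed_neq H i j : ~~ has (tryC_commits i) H -> has (tryC_commits j) H -> j != i.
Proof. by move=> ni hj; apply: contraNneq ni => <-. Qed.

Lemma upd_inj s kp clk i : (forall p, p \in begun s -> (kp p < clk)%N) ->
  {in begun s &, injective kp} -> {in i :: begun s &, injective (upd kp i clk)}.
Proof.
move=> lt inj p q; rewrite !inE /upd.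
case: (eqVneq p i) => [->|_] /=; case: (eqVneq q i) => [->|_] //=.
- by move=> _ /lt h E; move: h; rewrite E ltnn.
- by move=> /lt h _ E; move: h; rewrite E ltnn.
exact: inj.
Qed.

Lemma ends_begun s H rd i j : program_inv s H rd -> ends_before H i j ->
  [/\ i \in begun s, j \in begun s & has (@terminates R K V) (proj i H)].
Proof.
move=> inv /before_has [h1 h2]; rewrite !(pi_begun inv) !mem_txn has_in_proj; split=> //.
  by apply: sub_has h1 => e /andP [].
by apply: sub_has h2 => e /begins_txn ->; rewrite eqxx.
Qed.

Lemma order_inv_begin s H sg kp clk rd i its0 :
  program_inv s H rd -> order_inv s H sg kp clk rd ->
  i \notin begun s -> 0 < i -> (its0 <= gcounter s)%N ->
  order_inv (start s i its0) (rcons H (Begin i))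
    (upd sg i (gcounter s)) (upd kp i clk) clk.+1 rd.
Proof.
move=> inv oi ni i0 its_le.
have nc : ~~ has (tryC_commits i) H by apply: contra ni => /(committed_begun inv).
have bi p : p \in begun s -> p != i by move=> pb; apply: contraNneq ni => <-.
have cm p : has (tryC_commits p) (rcons H (Begin i)) = has (tryC_commits p) H.
  by rewrite has_rcons.
have wt p k : written p k (rcons H (Begin i)) = written p k H by rewrite written_rcons.
have wr k p : writer (rcons H (Begin i)) k p = writer H k p by rewrite /writer cm wt.
have ci p : has (tryC_commits p) H -> p != i by apply: committed_neq.
have ss q p : sees (rcons H (Begin i)) q p -> q != i -> sees H q p.
  rewrite /sees before_rcons => /orP [//|/andP [_ /andP [/eqP <-]]].
  by rewrite eqxx.
have sm q p : sees H q p -> sees (rcons H (Begin i)) q p.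
  by move=> h; rewrite /sees before_rcons -/(sees H q p) h.
split=> //=.
- by move=> p; rewrite inE => /orP [/eqP -> //|/(oi_pos oi)].
- move=> p; rewrite inE; case: eqP => [_|_] /=; first by rewrite leqW.
  by move/(oi_its oi) => h; rewrite leqW.
- move=> p; rewrite inE /upd; case: eqP => [_ _|_ /= /(oi_sg oi) [a b c]] /=.
    by rewrite leqnn leqnSn (oi_gcounter oi).
  by rewrite leqW.
- move=> p; rewrite inE /upd; case: eqP => [_|_ /= /(oi_kp oi)] //; exact: leqW.
- by apply: upd_inj; [exact: (oi_kp oi)|exact: (oi_inj oi)].
- move=> a b; rewrite /ends_before before_rcons => /orP [h|/andP [h /eqP Eb]].
    have [ha hb _] := ends_begun inv h.
    by rewrite /klt !upd_other ?bi //; apply: (oi_rt oi).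
  (* Real time: every old [sg] is at most [gcounter], the time of the new transaction, and the fresh
     clock decides a tie. *)
  have ab : a \in begun s.
    by rewrite (pi_begun inv) mem_txn; apply: sub_has h => e /andP [].
  rewrite -Eb /klt upd_self upd_other ?bi // upd_self upd_other ?bi //.
  by have := oi_kp oi ab; have [_ + _] := oi_sg oi ab; lia.
- move=> k; have := oi_node oi k; rewrite /node_inv -/(find_node s k) /=.
  have -> : find_node (start s i its0) k = find_node s k by [].
  case: (find_node s k) => [nd|] [].
    move=> h1 h2 h3 h4 h5; split=> // [v /h3 [?|[a b c]]|p]; last by rewrite wr; apply: h4.
      by left.
    by right; rewrite cm wt upd_other ?ci.
  by move=> h1 h2; split=> // p; rewrite wr.
- move=> k p q; rewrite !wr => h1 h2.
  rewrite !upd_other ?ci ?(writer_committed h1) ?(writer_committed h2) //.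
  exact: (oi_ww oi h1 h2).
- move=> q k j /(oi_rd oi) [h1 h2 h3]; rewrite inE h1 orbT; split=> //.
  rewrite (negbTE (bi _ h1)); case: h3 => [?|[a b c d]]; [by left|right].
  rewrite cm /klt !(upd_other _ _ (ci _ a)) !(upd_other _ _ (bi _ h1)).
  split=> //; exact: sm.
- move=> q k j p; case: eqP => [->|_] /=.
    by move=> _ /(oi_rd oi) [qb]; rewrite qb in ni.
  move=> h1 h2; rewrite wr => h3 h4; rewrite upd_other ?ci ?(writer_committed h3) //.
  exact: (oi_tutl oi h1 h2 h3 h4).
move=> q k j p h1; rewrite wr => h2 pq.
have qb : q \in begun s by have [] := oi_rd oi h1.
rewrite (negbTE (bi _ qb)) => h3.
rewrite /klt !(upd_other _ _ (bi _ qb)) !(upd_other _ _ (ci _ (writer_committed h2))).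
apply: (oi_vis oi h1 h2 pq); case: h3 => [?|h3]; [by left|right].
exact: ss h3 (bi _ qb).
Qed.

Definition upd_read rd i k j := fun q k' =>
  if (q == i) && (k' == k) then Some j else rd q k'.

(** * Shared reads and commits with updates *)

Section Steps.
Variables (s s' : state) (H : seq event) (sg kp : R -> nat) (clk : nat).
Variables (rd : R -> K -> option R) (x : event).
Let i := txn x.
Let H' := rcons H x.
Hypothesis inv : program_inv s H rd.
Hypothesis oi : order_inv s H sg kp clk rd.
Hypothesis open : (txn x \in begun s) && ~~ closed (tx s (txn x)).
Hypothesis nb : ~~ begins (txn x) x.

Let ext : extends H x H'.
Proof. by left. Qed.

Let ib : i \in begun s.
Proof. by case/andP: open. Qed.

Let nci : ~~ has (tryC_commits i) H.
Proof. exact: open_uncommitted inv open. Qed.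

Let ci p : has (tryC_commits p) H -> p != i.
Proof. exact: committed_neq. Qed.

Let wi k p : writer H k p -> p != i.
Proof. by move/writer_committed/ci. Qed.

(** An open transaction precedes nothing in real time, so raising its key only moves a right end
    upwards. *)
Let rt_raise n : (sg i <= n)%N -> forall a b, ends_before H' a b ->
  klt (upd sg i n) (upd kp i clk) a b.
Proof.
move=> le a b /(extends_ends inv ext open) h.
have {}h : ends_before H a b by apply: h; apply: contra nb => bx; rewrite (begins_txn bx).
have [ha hb ta] := ends_begun inv h.
have ai : a != i.
  apply: contraTneq ta => ->; rewrite -(pi_closed inv) //; by case/andP: open.
have := oi_rt oi h; rewrite /klt !(upd_other _ _ ai).
have [->|bi] := eqVneq b i; last by rewrite !upd_other.
by rewrite !upd_self => h1; apply: lexi_raise h1 le (oi_kp oi ib).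
Qed.

Let inj_raise : {in begun s &, injective (upd kp i clk)}.
Proof.
move=> p q pb qb; apply: (upd_inj (s := s)); rewrite ?inE ?pb ?qb ?orbT //.
  exact: oi_kp oi.
exact: oi_inj oi.
Qed.

Let kp_raise p : p \in begun s -> (upd kp i clk p < clk.+1)%N.
Proof. by rewrite /upd; case: eqP => // _ /(oi_kp oi); apply: leqW. Qed.

Let version_committed k nd v : find_node s k = Some nd -> In v (vl nd) -> 0 < ts v ->
  writer H k (ts v) /\ vrt v = sg (ts v).
Proof.
move=> fn vin v0; have := oi_node oi k; rewrite /node_inv fn => -[_ _ h _ _].
case: (h v vin) => [[E _]|[a b c]]; first by rewrite E ltxx in v0.
by rewrite /writer a b.
Qed.

Let rd_ge0 q k j : rd q k = Some j -> 0 <= j.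
Proof.
case/(oi_rd oi) => _ _ [->|[cj _ _ _]] //; apply/ltW/(oi_pos oi).
exact: (committed_begun inv cj).
Qed.

Lemma In_add_reader (vs : seq version) j q v : In v (add_reader vs j q) ->
  exists2 w, In w vs & [/\ ts v = ts w, vval v = vval w & vrt v = vrt w].
Proof.
elim: vs => [|w vs IH] //= [<-|/IH [u ? ?]]; last by exists u; [right|].
by exists w; [left|case: ifP].
Qed.

Lemma add_reader_In (vs : seq version) j q w : In w vs -> exists v,
  [/\ In v (add_reader vs j q), ts v = ts w, {subset rvl w <= rvl v}
    & ts w = j -> q \in rvl v].
Proof.
elim: vs => [|u vs IH] //= [->|/IH [v [a b c d]]].
  exists (if ts w == j then Version (ts w) (vval w) (q :: rvl w) (vrt w) else w).
  split; first by left.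
  - by case: ifP.
  - by case: ifP => _ p pw //; rewrite -[_ \in _]/(p \in q :: rvl w) inE pw orbT.
  - by move=> ->; rewrite eqxx -[_ \in _]/(q \in q :: rvl w) inE eqxx.
by exists v; split=> //; right.
Qed.

Lemma map_ts_add_reader (vs : seq version) j q : map (@ts R V) (add_reader vs j q) = map (@ts R V) vs.
Proof. by rewrite -map_comp; apply: eq_map => v /=; case: ifP. Qed.

(** The time is raised to [vrt v] and not to the new lower limit: [(vrt v).+1] may exceed
    [gcounter], hence the time of a transaction that begins later. When the times coincide, the
    fresh clock puts the reader after the writer of [v]. *)
Lemma order_inv_read k nd m (v : version) next hi (lo := maxn (tltl (tx s i)) (vrt v).+1) :
  ~~ terminates x ->
  find_node s k = Some nd -> find_version (vl nd) i = Some (v, next) ->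
  hi = (if next is Some w then min_limit (tutl (tx s i)) (vrt w).-1 else tutl (tx s i)) ->
  ~~ exceeds lo hi ->
  stat (tx s i) = Live ->
  begun s' = begun s -> gcounter s' = gcounter s ->
  (forall k', find_node s' k' = if k' == k
     then Some (Node k m (add_reader (vl nd) (ts v) i)) else find_node s k') ->
  (forall p, p != i -> tx s' p = tx s p) ->
  [/\ its (tx s' i) = its (tx s i), stat (tx s' i) = Live, tltl (tx s' i) = lo
    & tutl (tx s' i) = hi] ->
  order_inv s' H' (upd sg i (maxn (sg i) (vrt v))) (upd kp i clk) clk.+1
    (upd_read rd i k (ts v)).
Proof.
move=> nt fn fv Ehi nex Li Eb Eg Efn Etx [Eits Est Elo Ehi'].
have [srt sz vok wok rok] : versions_inv H sg rd k (vl nd).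
  by have := oi_node oi k; rewrite /node_inv fn.
have [A [B [/= Evs _ Enx vi iB]]] := find_versionP srt fv.
have [hA hB] : (forall w, In w A -> ts w < ts v) /\ (forall w, In w B -> ts v < ts w).
  by apply: sorted_versions_cat; rewrite -Evs.
have vin : In v (vl nd) by rewrite Evs List.in_app_iff /=; auto.
have ncx : ~~ tryC_commits i x by apply: contra nt; apply: tryC_commits_terminates.
have wr k' p : writer H' k' p = writer H k' p.
  by apply: (extends_writer inv ext open); rewrite ncx.
have cm p : has (tryC_commits p) H -> has (tryC_commits p) H'.
  by rewrite (ext_tryC (extends_proj ext)) => ->; rewrite orbT.
have wt p k' : has (tryC_commits p) H -> written p k' H' = written p k' H.
  exact: (extends_committed_written inv ext open).
have [sg0 sgg sgt] := oi_sg oi ib.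
(* A writer whose version is lost is older than [v], which is still kept. *)
have below p : writer H k p -> p < i -> p <= ts v.
  move=> /wok [[u uin Eu]|lo_p] pi_; last by apply/ltW/lo_p.
  move: uin; rewrite Evs List.in_app_iff /= -Eu => -[/hA /ltW //|[-> //|/iB]].
  by rewrite Eu => ip; rewrite lt_geF in ip.
(* Writers with a timestamp above [i] lie beyond its upper limit: for [k] the limit is below the
   [vrt] of the next version, and [vrt] grows along the list. *)
have above k' j p : upd_read rd i k (ts v) i k' = Some j -> writer H k' p -> i < p ->
    exists2 m, hi = Some m & (m < sg p)%N.
  rewrite /upd_read eqxx /=; case: eqP => [-> _ wp ip|_ r wp ip]; last first.
    have [n E lt] := oi_tutl oi Li r wp ip.
    rewrite Ehi; case: (next) => [w|]; last by exists n.
    by rewrite E /=; exists (minn n (vrt w).-1) => //; apply: leq_ltn_trans (geq_minl _ _) lt.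
  have [[u uin Eu]|lo_p] := wok _ wp; last first.
    by have := lo_p _ vin => pv; move: (lt_trans ip (lt_trans pv vi)); rewrite ltxx.
  move: uin; rewrite Evs List.in_app_iff /= => -[/hA|[Euv|uB]].
  - by rewrite Eu => pv; move: (lt_trans ip (lt_trans pv vi)); rewrite ltxx.
  - by move: ip; rewrite -Eu -Euv lt_gtF.
  case: B Evs Enx iB hB uB => [|w B] // Evs Enx iB hB uB.
  have win : In w (vl nd) by rewrite Evs List.in_app_iff /=; auto.
  have iw : i <= ts w by apply: iB; left.
  have [ww Ew] := version_committed fn win (lt_le_trans (oi_pos oi ib) iw).
  have wp' : (vrt w <= sg p)%N.
    rewrite Ew; case: uB => [Ewu|uB]; first by rewrite Ewu Eu.
    apply/ltnW/(oi_ww oi ww wp); rewrite -Eu.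
    have : sorted_versions ((rcons A v) ++ w :: B) by rewrite cat_rcons -Evs.
    by case/sorted_versions_cat => _; apply.
  (* The limit is a truncated predecessor, strict only for a positive [vrt]; the next version is
     never that of T_0. *)
  have w0 : (0 < vrt w)%N.
    by rewrite Ew; have [] := oi_sg oi (committed_begun inv (writer_committed ww)).
  rewrite Ehi Enx /=; case: (tutl _) => [t|]; last by exists (vrt w).-1; rewrite ?prednK.
  by exists (minn t (vrt w).-1) => //; apply: leq_ltn_trans (geq_minr _ _) _; rewrite prednK.
have sg_lo : (maxn (sg i) (vrt v) <= lo)%N.
  by rewrite /lo geq_max !leq_max sgt leqnSn orbT.
have lo_hi n : hi = Some n -> (lo <= n)%N.
  by move=> E; move: nex; rewrite E /= -leqNgt.
split.
- by rewrite Eg; apply: (oi_gcounter oi).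
- by rewrite Eb; apply: (oi_pos oi).
- move=> p; rewrite Eb Eg => pb; have [->|pi_] := eqVneq p i.
    by rewrite Eits; apply: (oi_its oi).
  by rewrite Etx //; apply: (oi_its oi).
- move=> p; rewrite Eb Eg => pb; have [->|pi_] := eqVneq p i.
    rewrite upd_self Elo; split=> //; first by rewrite leq_max sg0.
    rewrite geq_max sgg; case: (vok v vin) => [[_ [_ ->]] //|[cv _ ->]].
    by have [] := oi_sg oi (committed_begun inv cv).
  by rewrite upd_other // Etx //; apply: (oi_sg oi).
- by move=> p; rewrite Eb; apply: kp_raise.
- by rewrite Eb; apply: inj_raise.
- by apply: rt_raise; apply: leq_maxl.
- move=> k'; rewrite /node_inv Efn; case: eqP => [->|nk] /=.
    split.
    + by rewrite /sorted_versions map_ts_add_reader.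
    + by rewrite size_map.
    + move=> u /In_add_reader [w /vok win [E1 E2 E3]]; rewrite E1 E2 E3.
      case: win => [?|[a b c]]; [by left|right].
      by split; rewrite ?wt ?upd_other ?ci //; apply: cm.
    + move=> p; rewrite wr => /wok [[u uin Eu]|lo_p].
        by have [w [a b _ _]] := add_reader_In (ts v) i uin; left; exists w; rewrite ?b.
      by right=> u /In_add_reader [w /lo_p ? [-> _ _]].
    move=> q j; rewrite /upd_read eqxx andbT; case: eqP => [->|_].
      case=> <-; have [w [a b c d]] := add_reader_In (ts v) i vin.
      by left; exists w; split=> //; apply: d.
    case/rok=> [[u [uin Eu qu]]|lo_j].
      have [w [a b c d]] := add_reader_In (ts v) i uin.
      by left; exists w; rewrite b; split=> //; apply: c.
    by right=> u /In_add_reader [w /lo_j ? [-> _ _]].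
  have := oi_node oi k'; rewrite /node_inv.
  case: (find_node s k') => [nd'|] [].
    move=> h1 h2 h3 h4 h5; split=> // [u /h3 [?|[a b c]]|p|q j].
    + by left.
    + by right; split; rewrite ?wt ?upd_other ?ci //; apply: cm.
    + by rewrite wr; apply: h4.
    + rewrite /upd_read; case: (k' =P k) => // _; rewrite andbF; exact: h5.
  move=> h1 h2; split=> [p|q]; first by rewrite wr.
  by rewrite /upd_read; case: (k' =P k) => // _; rewrite andbF.
- move=> k' p q; rewrite !wr => h1 h2; rewrite !upd_other ?(wi h1) ?(wi h2) //.
  exact: (oi_ww oi h1 h2).
- move=> q k' j; rewrite Eb /upd_read; case: (eqVneq q i) => [->|qi] /=; last first.
    move/(oi_rd oi) => [h1 h2 h3]; split=> //; case: h3 => [?|[a b c d]]; [by left|right].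
    rewrite /klt !(upd_other _ _ (ci a)) !(upd_other _ _ qi) Etx //; split=> //; first exact: cm.
    exact: (extends_sees inv ext open).
  case: eqP => [_ [<-]|_ /(oi_rd oi) [h1 h2 h3]]; split=> //.
    case: (vok v vin) => [[? _]|[cv _ Ev]]; [by left|right].
    rewrite /klt !(upd_other _ _ (ci cv)) !upd_self Elo; split; first exact: cm.
    + by apply: lexi_le (oi_kp oi (committed_begun inv cv)); rewrite -Ev leq_maxr.
    + rewrite /sees before_rcons cv /succeeds eqxx /= orbC.
      by have := nt; rewrite /terminates negb_or => /andP [->].
    by rewrite -Ev /lo leq_max ltnSn orbT.
  case: h3 => [?|[a b c d]]; [by left|right].
  rewrite /klt !(upd_other _ _ (ci a)) !upd_self Elo; split; first exact: cm.
  + by apply: lexi_raise b _ (oi_kp oi ib); apply: leq_maxl.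
  + exact: (extends_sees inv ext open).
  exact: leq_trans d (leq_maxl _ _).
- move=> q k' j p; rewrite wr => h1 h2 h3; rewrite (upd_other _ _ (wi h3)).
  move: h1 h2; have [->|qi] := eqVneq q i.
    by move=> _ h2 ip; rewrite Ehi'; apply: above h2 h3 ip.
  by rewrite Etx // /upd_read (negbTE qi) /= => h1 h2; apply: (oi_tutl oi h1 h2 h3).
move=> q k' j p; rewrite wr => h1 h2 pq h3; have [Eq|qi] := eqVneq q i; last first.
  rewrite /klt !(upd_other _ _ (wi h2)) !(upd_other _ _ qi).
  move: h1 h3; rewrite Etx // /upd_read (negbTE qi) /= => h1 h3.
  apply: (oi_vis oi h1 h2 pq); case: h3 => [?|]; [by left|].
  by case/(extends_sees_inv inv ext open) => [|[E _]]; [right|rewrite E eqxx in qi].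
have nf : stat (tx s i) <> StFalse by rewrite Li.
rewrite Eq in h1 pq *; split=> [pi_|ip].
  move: h1; rewrite /upd_read eqxx /=; case: eqP => [Ek [<-]|_ h1].
    by apply: below => //; rewrite -Ek.
  by have [h _] := oi_vis oi h1 h2 pq (or_introl nf); apply: h.
have [n En lt] := above _ _ _ h1 h2 ip.
rewrite /klt upd_self !(upd_other _ _ (wi h2)); apply/orP; left.
exact: leq_ltn_trans sg_lo (leq_ltn_trans (lo_hi _ En) lt).
Qed.

(** A key without a node has no writer, so reading it from T_0 puts no constraint on the serial
    order and T_i keeps its place. *)
Lemma order_inv_read_fresh k :
  (0 < nversions)%N -> ~~ terminates x ->
  find_node s k = None ->
  begun s' = begun s -> gcounter s' = gcounter s ->
  (forall k', find_node s' k' = if k' == k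
     then Some (Node k true [:: initial_version V i]) else find_node s k') ->
  (forall p, [/\ its (tx s' p) = its (tx s p), stat (tx s' p) = stat (tx s p),
    tltl (tx s' p) = tltl (tx s p) & tutl (tx s' p) = tutl (tx s p)]) ->
  stat (tx s i) = Live ->
  order_inv s' H' sg kp clk (upd_read rd i k 0).
Proof.
move=> n0 nt fn Eb Eg Efn Etx Li.
have ncx : ~~ tryC_commits i x by apply: contra nt; apply: tryC_commits_terminates.
have wr k' p : writer H' k' p = writer H k' p.
  by apply: (extends_writer inv ext open); rewrite ncx.
have cm p : has (tryC_commits p) H -> has (tryC_commits p) H'.
  by rewrite (ext_tryC (extends_proj ext)) => ->; rewrite orbT.
have wt p k' : has (tryC_commits p) H -> written p k' H' = written p k' H.
  exact: (extends_committed_written inv ext open).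
have [nw nr] : (forall i, ~~ writer H k i) /\ (forall q, rd q k = None).
  by have := oi_node oi k; rewrite /node_inv fn.
have rdE q k' j : upd_read rd i k 0 q k' = Some j ->
    [/\ q = i, k' = k & j = 0] \/ rd q k' = Some j.
  rewrite /upd_read; case: (q =P i) => [->|_] /=; last by right.
  by case: (k' =P k) => [-> [<-]|_]; [left|right].
split.
- by rewrite Eg; apply: (oi_gcounter oi).
- by rewrite Eb; apply: (oi_pos oi).
- by move=> p; rewrite Eb Eg; have [-> _ _ _] := Etx p; apply: (oi_its oi).
- by move=> p; rewrite Eb Eg; have [_ _ -> _] := Etx p; apply: (oi_sg oi).
- by rewrite Eb; apply: (oi_kp oi).
- by rewrite Eb; apply: (oi_inj oi).
- move=> a b /(extends_ends inv ext open) h; apply: (oi_rt oi); apply: h.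
  by apply: contra nb => bx; rewrite (begins_txn bx).
- move=> k'; rewrite /node_inv Efn; case: eqP => [->|nk] /=.
    split=> //.
    + by move=> v [<-|//]; left.
    + by move=> p; rewrite wr (negbTE (nw p)).
    move=> q j /rdE [[-> _ ->]|]; last by rewrite nr.
    by left; exists (initial_version V i); split; [left| |rewrite inE eqxx].
  have := oi_node oi k'; rewrite /node_inv.
  case: (find_node s k') => [nd'|] [].
    move=> h1 h2 h3 h4 h5; split=> // [u /h3 [?|[a b c]]|p|q j].
    + by left.
    + by right; split; rewrite ?wt ?upd_other ?ci //; apply: cm.
    + by rewrite wr; apply: h4.
    + by case/rdE => [[_ /nk]|/h5].
  move=> h1 h2; split=> [p|q]; first by rewrite wr.
  by rewrite /upd_read; case: (k' =P k) => // _; rewrite andbF.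
- by move=> k' p q; rewrite !wr => h1 h2; apply: (oi_ww oi h1 h2).
- move=> q k' j; rewrite Eb => /rdE [[-> _ ->]|/(oi_rd oi) [h1 h2 h3]]; split=> //.
  + exact: (oi_pos oi).
  + by left.
  case: h3 => [?|[a b c d]]; [by left|right]; have [_ _ -> _] := Etx q; split=> //; first exact: cm.
  exact: (extends_sees inv ext open).
- move=> q k' j p; have [_ -> _ ->] := Etx q; rewrite wr => h1 /rdE [[_ -> _]|h2 h3].
    by rewrite (negbTE (nw p)).
  exact: (oi_tutl oi h1 h2 h3).
move=> q k' j p /rdE [[_ -> _]|h1]; rewrite wr; first by rewrite (negbTE (nw p)).
have [_ -> _ _] := Etx q; move=> h2 pq h3; apply: (oi_vis oi h1 h2 pq).
case: h3 => [?|]; [by left|].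
case/(extends_sees_inv inv ext open) => [|[-> _]]; first by right.
by left; rewrite -/i Li.
Qed.

(** It remains to place [h] among the times of the writers and readers of each updated key. The
    neighbours of the new version settle the writers; the reader list of its predecessor, with
    [oi_vis] for older reads, settles the readers. *)
Lemma order_inv_commit incrVal each_key s1 (us := updates s i)
    (s2 := foldl (apply_update nversions hash i) s1 us) (h := tltl (tx s1 i)) :
  (0 < nversions)%N -> x = TryC i true ->
  validate incrVal hash each_key s i [::] (map fst us) = (s1, true) ->
  us <> [::] -> stat (tx s i) = Live ->
  s' = set_tx s2 i (close (tx s2 i) Committed) ->
  order_inv s' H' (upd sg i h) (upd kp i clk) clk.+1 rd.
Proof.
move=> n0 Ex val us0 Li Es'.
have uu : uniq (map fst us) by apply: updates_uniq; apply: (pi_uniq inv).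
have [st [|col [h' [[s0 [st0 ck]] _ fk]]]] := validateP val.
  by move=> E; apply: us0; case: (us) E.
have {h' ck} ck : checked s0 i col s1 h by rewrite /h (ck_tltl ck).
have [Et2 Eb2 Eg2] := apply_updates_tx nversions hash i us s1.
have Etx p : tx s' p = if p == i then close (tx s1 i) Committed else tx s1 p.
  by rewrite Es' /= /s2 Et2.
have Eb : begun s' = begun s by rewrite Es' /= /s2 Eb2 (ls_begun st).
have Eg : gcounter s' = gcounter s1 by rewrite Es' /= /s2 Eg2.
have Efn k : find_node s' k = if entry us k is Some u then
    Some (Node k (~~ isSome u.2) (add_version nversions
      (if find_node s k is Some nd then vl nd else [:: initial_version V i])
      (Version i u.2 [::] h)))
  else find_node s k.
  rewrite Es' -[LHS]/(find_node s2 k) find_apply_updates //.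
  by have -> : find_node s1 k = find_node s k by rewrite /Defs.find_node (ls_table st).
have wti k : written i k H' = written i k H by rewrite (ext_written (extends_proj ext)) Ex.
have cm p : has (tryC_commits p) H -> has (tryC_commits p) H'.
  by rewrite (ext_tryC (extends_proj ext)) => ->; rewrite orbT.
have cmi : has (tryC_commits i) H'.
  by rewrite (ext_tryC (extends_proj ext)) Ex /= eqxx.
have wt p k : has (tryC_commits p) H -> written p k H' = written p k H.
  exact: (extends_committed_written inv ext open).
have wr k p : p != i -> writer H' k p = writer H k p.
  move=> pi_; rewrite /writer (ext_tryC (extends_proj ext)) {1}Ex /= eq_sym (negbTE pi_) /=.
  by case: (boolP (has _ H)) => //= /wt ->.
have went k : if written i k H is Some w then entry us k = Some (k, w) else entry us k = None.
  rewrite /us entry_updates ?(pi_uniq inv) // (pi_written inv).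
  by case: (logged s i k) => [[w []]|].
have [sg0 sgg sgt] := oi_sg oi ib.
have th : (tltl (tx s i) <= h)%N by rewrite /h (ls_tltl st).
have h0 : (0 < h)%N by apply: leq_trans th; apply: leq_trans sgt.
have ipos : 0 < i by apply: (oi_pos oi).
have Lstat q : stat (tx s1 q) = Live -> stat (tx s q) = Live.
  by move=> E; case: (ls_stat st q) => [<-|[]].
have Fstat q : stat (tx s1 q) <> StFalse -> stat (tx s q) <> StFalse.
  by move=> E; case: (ls_stat st q) => [<-|[->]].
have found k nd : writer H' k i -> find_node s k = Some nd ->
    exists2 c, find_version (vl nd) i = Some c & In c col.
  case/andP=> _; rewrite wti => wi'; apply: fk; have := went k.
  by case: (written i k H) wi' => // w _ /entry_In.
(* Only the neighbouring versions were compared with [h]; monotonicity of [sg] along the writers of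
   [k] extends this to all of them, lost ones included. *)
have writers k p : writer H' k i -> writer H k p ->
    (p < i -> (sg p < h)%N) /\ (i < p -> (h < sg p)%N).
  move=> wik wp; have := oi_node oi k; rewrite /node_inv.
  case fn: (find_node s k) => [nd|]; last by case=> /(_ p); rewrite wp.
  case=> srt _ vok wok _; have [c fv cc] := found _ _ wik fn.
  have [A [B [Evs _ Enx vi iB]]] := find_versionP srt fv.
  have [hA hB] : (forall w, In w A -> ts w < ts c.1) /\ (forall w, In w B -> ts c.1 < ts w).
    by apply: sorted_versions_cat; rewrite -Evs.
  have vin : In c.1 (vl nd) by rewrite Evs List.in_app_iff /=; auto.
  have p0 : 0 < p by apply/(oi_pos oi)/(committed_begun inv)/(writer_committed wp).
  split=> [pi_|ip].
    have pc : p <= ts c.1.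
      case: (wok p wp) => [[u uin Eu]|/(_ _ vin) /ltW //].
      move: uin; rewrite Evs List.in_app_iff /= -Eu => -[/hA /ltW //|[-> //|/iB]].
      by rewrite Eu => ip; rewrite lt_geF in ip.
    have [wc Ec] := version_committed fn vin (lt_le_trans p0 pc).
    apply: leq_ltn_trans (ck_prev ck cc); rewrite Ec.
    by move: pc; rewrite le_eqVlt => /orP [/eqP -> //|/(oi_ww oi wp wc) /ltnW].
  case: (wok p wp) => [[u uin Eu]|/(_ _ vin) pv]; last first.
    by move: (lt_trans ip (lt_trans pv vi)); rewrite ltxx.
  move: uin; rewrite Evs List.in_app_iff /= => -[/hA|[Euv|uB]].
  - by rewrite Eu => pv; move: (lt_trans ip (lt_trans pv vi)); rewrite ltxx.
  - by move: ip; rewrite -Eu -Euv lt_gtF.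
  case: B Evs Enx iB hB uB => [|w B] // Evs Enx iB hB uB.
  have win : In w (vl nd) by rewrite Evs List.in_app_iff /=; auto.
  have iw : i <= ts w by apply: iB; left.
  have [ww Ew] := version_committed fn win (lt_le_trans ipos iw).
  have w0 : (0 < vrt w)%N.
    by rewrite Ew; have [] := oi_sg oi (committed_begun inv (writer_committed ww)).
  have hw : (h < vrt w)%N by have := ck_next ck cc Enx; rewrite -ltnS prednK.
  apply: leq_trans hw _; rewrite Ew.
  case: uB => [Ewu|uB]; first by rewrite Ewu Eu.
  apply/ltnW/(oi_ww oi ww wp); rewrite -Eu.
  have : sorted_versions ((rcons A c.1) ++ w :: B) by rewrite cat_rcons -Evs.
  by case/sorted_versions_cat => _; apply.
have readers k q j : writer H' k i -> rd q k = Some j -> q != i ->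
    stat (tx s1 q) <> StFalse ->
    (i < q -> i <= j) /\
    (q < i -> (sg q <= h)%N /\
       (stat (tx s1 q) = Live -> exists2 m, tutl (tx s1 q) = Some m & (m < h)%N)).
  move=> wik rq qi nf; have := oi_node oi k; rewrite /node_inv.
  case fn: (find_node s k) => [nd|]; last by case=> _ /(_ q); rewrite rq.
  case=> srt _ vok wok rok; have [c fv cc] := found _ _ wik fn.
  have [A [B [Evs _ Enx vi iB]]] := find_versionP srt fv.
  have [hA hB] : (forall w, In w A -> ts w < ts c.1) /\ (forall w, In w B -> ts c.1 < ts w).
    by apply: sorted_versions_cat; rewrite -Evs.
  have vin : In c.1 (vl nd) by rewrite Evs List.in_app_iff /=; auto.
  have [qb jq _] := oi_rd oi rq.
  (* A reader of a version older than [i] is either listed in the predecessor [c.1] or has read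
     something older still; then [c.1] belongs to a committed writer, with which [oi_vis] compares
     the reader unless they coincide. *)
  have cases : j < i -> (ts c.1 = j /\ q \in rvl c.1) \/
      [/\ j < ts c.1, writer H k (ts c.1) & vrt c.1 = sg (ts c.1)].
    move=> ji; have older : j < ts c.1 -> [/\ j < ts c.1, writer H k (ts c.1) & vrt c.1 = sg (ts c.1)].
      move=> jc; have [] := version_committed fn vin (le_lt_trans (rd_ge0 rq) jc).
      by split.
    case: (rok q j rq) => [[u [uin Eu qu]]|/(_ _ vin) /older]; last by right.
    move: uin; rewrite Evs List.in_app_iff /= => -[/hA|[Euv|/iB]].
    - by rewrite Eu => /older; right.
    - by left; rewrite Euv.
    by rewrite Eu leNgt ji.
  (* A larger reader listed in [c.1] has been aborted by the check; one that skipped [c.1] would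
     contradict [oi_vis]. *)
  split=> [iq|qi'].
    rewrite leNgt; apply/negP => /cases [[_ qr]|[jc wc _]].
      by apply: nf; apply: (ck_large ck cc qr iq).
    have cq : ts c.1 < q by apply: lt_trans vi iq.
    have cq' : ts c.1 <> q by move=> E; rewrite E ltxx in cq.
    have [/(_ cq) + _] := oi_vis oi rq wc cq' (or_introl (Fstat _ nf)).
    by rewrite leNgt jc.
  have [_ _ sgq] := oi_sg oi qb.
  case: (cases (lt_trans jq qi')) => [[_ qr]|[jc wc Ec]].
    have [tq lq] := ck_small ck cc qr qi' nf.
    split; first by apply: leq_trans tq; apply: leq_trans sgq (ls_tltl st q).
    move=> /lq; case: (tutl _) => [m|] //= hm; exists m => //.
    by rewrite -(prednK h0) ltnS.
  have ch := ck_prev ck cc; rewrite Ec in ch.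
  (* Bounds known against the writer of [c.1] carry over to [h], which exceeds [vrt c.1]. In the
     last case the reader is that writer itself. *)
  case: (ltgtP (ts c.1) q) => [cq|qc|Ecq].
  - have cq' : ts c.1 <> q by move=> E; rewrite E ltxx in cq.
    have [/(_ cq) + _] := oi_vis oi rq wc cq' (or_introl (Fstat _ nf)).
    by rewrite leNgt jc.
  - have cq' : ts c.1 <> q by move=> E; rewrite E ltxx in qc.
    have [_ /(_ qc) kq] := oi_vis oi rq wc cq' (or_introl (Fstat _ nf)).
    split.
      apply: leq_trans (ltnW ch).
      by case/orP: kq => [/ltnW //|/andP [/eqP -> _]].
    move=> /Lstat Lq; have [m Em mc] := oi_tutl oi Lq rq wc qc.
    have := ls_tutl st q; rewrite Em => /le_limit_some [m' Em' le].
    by exists m' => //; apply: leq_ltn_trans le (ltn_trans mc ch).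
  - rewrite -Ecq; split; first exact: ltnW.
    move=> /Lstat; have /(pi_stat inv) -> := writer_committed wc.
    by [].
split.
- by rewrite Eg; apply: leq_trans (oi_gcounter oi) (ls_gcounter st).
- by rewrite Eb; apply: (oi_pos oi).
- move=> p; rewrite Eb Eg Etx => pb.
  have -> : its (if p == i then close (tx s1 i) Committed else tx s1 p) = its (tx s p).
    by case: eqP => [->|_] /=; rewrite (ls_its st).
  exact: leq_trans (oi_its oi pb) (ls_gcounter st).
- move=> p; rewrite Eb Eg Etx => pb; case: (eqVneq p i) => [->|pi_].
    by rewrite upd_self /=; split=> //; apply: (ck_gcounter ck).
  rewrite upd_other //; have [a b c] := oi_sg oi pb; split=> //.
    exact: leq_trans b (ls_gcounter st).
  exact: leq_trans c (ls_tltl st p).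
- by move=> p; rewrite Eb; apply: kp_raise.
- by rewrite Eb; apply: inj_raise.
- by apply: rt_raise; apply: leq_trans sgt th.
- move=> k; rewrite /node_inv Efn; have := oi_node oi k; rewrite /node_inv.
  have wik : writer H' k i = isSome (entry us k).
    by rewrite /writer cmi wti; have := went k; case: (written i k H) => [w|] ->.
  case Eu: (entry us k) => [u|]; last first.
    have wr' p : writer H' k p = writer H k p.
      have [->|pi_] := eqVneq p i; last exact: wr.
      by rewrite wik Eu /writer (negbTE nci).
    case: (find_node s k) => [nd|] [].
      move=> h1 h2 h3 h4 h5; split=> // [v /h3 [?|[a b c]]|p]; last by rewrite wr'; apply: h4.
        by left.
      by right; split; rewrite ?wt ?(upd_other _ _ (ci a)) //; apply: cm.
    by move=> h1 h2; split=> // p; rewrite wr'.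
  rewrite Eu in wik; have Wu : written i k H' = Some u.2.
    by rewrite wti; have := went k; case: (written i k H) => [w|]; rewrite Eu // => -[->].
  have newok vs c : versions_inv H sg rd k vs -> find_version vs i = Some c ->
      versions_inv H' (upd sg i h) rd k
        (add_version nversions vs (Version i u.2 [::] h)).
    case=> srt sz vok wok rok fv; set vs' := add_version _ _ _.
    have new w : In w vs -> ts w <> i.
      case/vok => [[-> _] E|[cw _ _]]; first by rewrite -E ltxx in ipos.
      exact/eqP/ci.
    have [a b c' d e] := @add_versionP R V nversions vs (Version i u.2 [::] h) c n0 srt sz fv new.
    have [A [B [Evs _ _ vi _]]] := find_versionP srt fv.
    have vin : In c.1 vs by rewrite Evs List.in_app_iff /=; auto.
    have lost_new j : lost j vs -> lost j vs'.
      move=> lj v /d [->|/lj //] /=; exact: lt_trans (lj _ vin) vi.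
    split=> //.
    + move=> v /d [->|/vok [?|[cv wv Ev]]].
      * by right; rewrite upd_self.
      * by left.
      * by right; split; rewrite ?wt ?(upd_other _ _ (ci cv)) //; apply: cm.
    + move=> p; have [->|pi_] := eqVneq p i.
        by left; exists (Version i u.2 [::] h).
      rewrite wr // => /wok [[v /e [?|?] <-]|/lost_new]; [left|right|right] => //.
      by exists v.
    + move=> q j /rok [[v [/e [?|?] <- qv]]|/lost_new]; [left|right|right] => //.
      by exists v.
  case: (find_node s k) (found k) => [nd|] fnd.
    by move=> vsi; have [c fv _] := fnd _ wik erefl; apply: (newok _ c).
  (* In a fresh node the predecessor is the version of T_0, because [i] is positive. *)
  case=> h1 h2; apply: (newok _ (initial_version V i, None)); last first.
    by rewrite /find_version /position /= leNgt ipos.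
  split=> // [v [<-|//]|p|q j]; first by left.
    by rewrite (negbTE (h1 p)).
  by rewrite h2.
- move=> k p q; have [->|pi_] := eqVneq p i; have [->|qi] := eqVneq q i.
  + by move=> _ _; rewrite ltxx.
  + rewrite upd_self (upd_other _ _ qi) (wr _ _ qi) => h1 h2; by have [_] := writers _ _ h1 h2.
  + rewrite upd_self (upd_other _ _ pi_) (wr _ _ pi_) => h1 h2; by have [] := writers _ _ h2 h1.
  + by rewrite !upd_other // !wr // => h1 h2; apply: (oi_ww oi h1 h2).
- move=> q k j /(oi_rd oi) [h1 h2 h3]; rewrite Eb; split=> //.
  case: h3 => [?|[a b c d]]; [by left|right]; split; first exact: cm.
  (* The lower limit strictly exceeds the time of each committed version read, hence so does [h],
     and the first component decides. *)
  + rewrite /klt !(upd_other _ _ (ci a)); have [Eq|qi] := eqVneq q i.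
      by rewrite Eq !upd_self; rewrite Eq in d; apply/orP; left; apply: leq_trans d th.
    by rewrite !upd_other.
  + exact: (extends_sees inv ext open).
  rewrite (upd_other _ _ (ci a)) Etx.
  have -> : tltl (if q == i then close (tx s1 i) Committed else tx s1 q) = tltl (tx s1 q).
    by case: eqP => [->|_].
  exact: leq_trans d (ls_tltl st q).
- move=> q k j p; rewrite Etx; case: (eqVneq q i) => [->|qi] //= Lq rq.
  have [->|pi_] := eqVneq p i => [wik qp|].
    have nf : stat (tx s1 q) <> StFalse by rewrite Lq.
    by rewrite upd_self; have [_ /(_ qp) [_]] := readers _ _ _ wik rq qi nf; apply.
  rewrite wr // upd_other // => wp qp.
  have [m Em mc] := oi_tutl oi (Lstat _ Lq) rq wp qp.
  have := ls_tutl st q; rewrite Em => /le_limit_some [m' Em' le].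
  by exists m' => //; apply: leq_ltn_trans le mc.
have nfi : stat (tx s i) <> StFalse by rewrite Li.
move=> q k j p rq wp pq vis; have [Eq|qi] := eqVneq q i.
  rewrite Eq in rq pq *.
  have pi_ : p != i by apply/eqP.
  rewrite wr // in wp; have [a _] := oi_vis oi rq wp pq (or_introl nfi).
  (* [h] does not exceed the upper limit T_i had, which lies before every writer of larger timestamp
     of a key it has read. *)
  split=> // ip; have [m Em mp] := oi_tutl oi Li rq wp ip.
  rewrite /klt upd_self upd_other //; apply/orP; left.
  apply: leq_ltn_trans mp.
  have := le_limit_trans (ls_tutl st0 i) (ck_tutl ck).
  by rewrite Em.
rewrite Etx (negbTE qi) in vis.
have seen : sees H' q p -> sees H q p.
  by case/(extends_sees_inv inv ext open) => [//|[E _]]; rewrite E eqxx in qi.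
have [Ep|pi_] := eqVneq p i.
  rewrite Ep in wp vis pq seen *.
  (* The commit of T_i is the last event of [H']: no other transaction can have seen it yet. *)
  have nf : stat (tx s1 q) <> StFalse.
    by case: vis => // /seen /before_has [c _]; case/negP: nci.
  have [a b] := readers _ _ _ wp rq qi nf; split=> // /b [le _].
  rewrite /klt !upd_self !upd_other //; apply: lexi_le => //.
  by apply: (oi_kp oi); have [] := oi_rd oi rq.
rewrite wr // in wp; rewrite /klt !upd_other //.
apply: (oi_vis oi rq wp pq); case: vis => [/Fstat|/seen]; by [left|right].
Qed.

End Steps.

(** * Preservation of the invariant by each method *)

Lemma terminates_view x i k w : terminates x -> view_step i k w x = w.
Proof. by case: x => // [? ? []|? ? []]. Qed.

Lemma terminates_write x i k w : terminates x -> write_step i k w x = w.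
Proof. by case: x => // ? ? []. Qed.

Lemma terminates_returns x : terminates x -> returns x = None.
Proof. by case: x => // [? ? []|? ? []]. Qed.

Lemma terminates_begins x i : terminates x -> begins i x = false.
Proof. by case: x. Qed.

Lemma aborts_tryC_commits x i : aborts x -> tryC_commits i x = false.
Proof. by case: x => // ? []. Qed.

Lemma logged_put_log s i k w u j k' : logged (put_log s i k w u) j k' =
  if (j == i) && (k' == k) then Some (w, u) else logged s j k'.
Proof.
rewrite /logged /=; have [->|//] := eqVneq j i.
rewrite /= eq_sym; have [->|ne] := eqVneq k' k => //=.
rewrite -filter_predI; congr (omap _ (ohead _)); apply: eq_filter => y /=.
by case: eqP => // ->; rewrite ne.
Qed.

Lemma put_log_uniq s i k w u j : uniq (map fst (log (tx s j))) ->
  uniq (map fst (log (tx (put_log s i k w u) j))).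
Proof.
move=> h /=; case: eqP => [Ej|//] /=; subst j.
apply/andP; split.
  by elim: (log _) => [|y l IH] //=; case: eqP => //= /eqP ne; rewrite inE eq_sym (negbTE ne).
elim: (log _) h => [|y l IH] //= /andP [ny /IH ul]; case: eqP => //= _; rewrite ul andbT.
apply: contra ny; elim: (l) => [|z l' IH'] //=; case: eqP => //= _; rewrite !inE.
  by move/IH' ->; rewrite orbT.
by case/orP=> [->|/IH' ->]; rewrite ?orbT.
Qed.

Lemma program_inv_close s s1 s' H rd x st (i := txn x) :
  program_inv s H rd -> limits_step s s1 i ->
  (i \in begun s) && ~~ closed (tx s i) ->
  terminates x -> (st = Committed <-> tryC_commits i x) ->
  begun s' = begun s ->
  (forall p, tx s' p = if p == i then close (tx s1 i) st else tx s1 p) ->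
  program_inv s' (rcons H x) rd.
Proof.
move=> inv ls open tm Est Eb Etx.
have lg p k : logged s' p k = logged s p k.
  by rewrite /logged Etx; case: eqP => [->|_] /=; rewrite (ls_log ls).
apply: (program_inv_step inv) => //.
- by rewrite terminates_begins.
- by rewrite terminates_begins.
- move=> p /negbTE pi_; rewrite Etx pi_ (ls_log ls) (ls_closed ls); split=> //.
  by case: (ls_stat ls p) => [->|[-> ->]].
- by rewrite Etx eqxx tm.
- by rewrite Etx eqxx.
- by rewrite Etx eqxx /= (ls_log ls); apply: (pi_uniq inv).
- by move=> k; rewrite lg terminates_view.
- by move=> k; rewrite lg terminates_write.
- by move=> k r; rewrite terminates_returns.
- by move=> q k j; left.
Qed.

Lemma order_inv_close s s1 s' H sg kp clk rd x st (i := txn x) :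
  program_inv s H rd -> order_inv s H sg kp clk rd ->
  limits_step s s1 i ->
  (i \in begun s) && ~~ closed (tx s i) ->
  terminates x -> aborts x \/ stat (tx s i) <> StFalse ->
  (forall k, ~~ tryC_commits i x || ~~ isSome (written i k H)) ->
  st <> Live -> (st = StFalse \/ stat (tx s i) <> StFalse) ->
  table s' = table s1 -> begun s' = begun s -> gcounter s' = gcounter s1 ->
  (forall p, tx s' p = if p == i then close (tx s1 i) st else tx s1 p) ->
  order_inv s' (rcons H x) sg kp clk rd.
Proof.
move=> inv oi ls open tm ab nw nl fl Et Eb Eg Etx.
apply: (order_inv_quiet inv (or_introl erefl) open oi) => //.
- by rewrite terminates_begins.
- by case: ab => [?|?]; [apply: Or31|apply: Or32].
- by rewrite Et (ls_table ls).
- by rewrite Eg (ls_gcounter ls).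
- move=> p; rewrite Etx; case: eqP => [->|_] /=;
    by rewrite (ls_its ls); split=> //; apply: (ls_tltl ls).
- move=> p; rewrite Etx; case: eqP => [//|_] L; split; last exact: (ls_tutl ls).
  by case: (ls_stat ls p) => [<-|[]].
move=> p; rewrite Etx; case: eqP => [->|_] /=.
  by case: fl => [->|].
by case: (ls_stat ls p) => [->|[->]].
Qed.

Definition invariant s H := exists sg kp clk rd,
  program_inv s H rd /\ order_inv s H sg kp clk rd.

Lemma abort_step s s1 H sg kp clk rd x (i := txn x) :
  program_inv s H rd -> order_inv s H sg kp clk rd -> limits_step s s1 i ->
  (i \in begun s) && ~~ closed (tx s i) -> aborts x ->
  invariant (abort s1 i) (rcons H x).
Proof.
move=> inv oi ls open ab; exists sg, kp, clk, rd.
have tm : terminates x by rewrite /terminates ab.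
split.
  apply: (program_inv_close (st := StFalse) inv ls open tm) => //=.
    by rewrite aborts_tryC_commits.
  by rewrite (ls_begun ls).
apply: (order_inv_close (st := StFalse) inv oi ls open tm) => //=.
- by left.
- by move=> k; rewrite aborts_tryC_commits.
- by left.
- by rewrite (ls_begun ls).
Qed.

Lemma open_live s H rd i : program_inv s H rd ->
  ~~ closed (tx s i) -> is_false (tx s i) = false -> stat (tx s i) = Live.
Proof.
move=> inv ncl; rewrite /is_false; case E: (stat (tx s i)) => //.
by move/(pi_stat inv): E => /(committed_closed inv) cl; rewrite cl in ncl.
Qed.

Lemma log_step s H i k w u x :
  invariant s H -> can_invoke s i -> txn x = i ->
  ~~ terminates x -> ~~ begins i x ->
  (forall k', view_step i k' (omap fst (logged s i k')) x =
     if k' == k then Some w else omap fst (logged s i k')) ->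
  (forall k', write_step i k' (updated (logged s i k')) x =
     if k' == k then updated (Some (w, u)) else updated (logged s i k')) ->
  (forall k' r, returns x = Some (i, k', r) ->
     exists u', logged s i k' = Some (r, u')) ->
  invariant (put_log s i k w u) (place x H).
Proof.
case=> sg [kp [clk [rd [inv oi]]]] open Ex nt nb vw wr rt.
exists sg, kp, clk, rd; split.
  apply: (program_inv_step inv (x := x)); rewrite ?Ex //.
  - by move=> j; rewrite proj_place.
  - by rewrite (negbTE nb).
  - by rewrite (negbTE nb).
  - by move=> p /negbTE pi_ /=; rewrite pi_.
  - by case/andP: open => _ /negbTE; rewrite /= eqxx (negbTE nt).
  - rewrite /= eqxx /=; have -> : tryC_commits i x = false.
      by apply: contraNF nt; apply: tryC_commits_terminates.
    split=> // E; case/andP: open => _ /negP []; apply: (committed_closed inv).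
    exact/(pi_stat inv).
  - by apply: put_log_uniq; apply: (pi_uniq inv).
  - by move=> k'; rewrite vw logged_put_log eqxx /=; case: eqP.
  - by move=> k'; rewrite wr logged_put_log eqxx /=; case: eqP.
  - by move=> k' r /rt [u' ->].
  - by move=> q k' j; left.
apply: (order_inv_quiet inv (x := x) (or_intror (conj erefl nt)) _ oi); rewrite ?Ex //.
- move=> k'; apply/orP; left.
  by apply: contra nt; apply: tryC_commits_terminates.
- exact: Or33.
- by move=> p /=; case: eqP => [->|].
- by move=> p /=; case: eqP => [->|]; rewrite ?le_limit_refl.
- by move=> p /=; case: eqP => [->|].
Qed.

Lemma log_lookup_step s H i k w u :
  invariant s H -> can_invoke s i -> logged s i k = Some (w, u) ->
  invariant s (place (Lookup i k (Ret w)) H).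
Proof.
case=> sg [kp [clk [rd [inv oi]]]] open lg.
exists sg, kp, clk, rd; split.
  apply: (program_inv_step inv (x := Lookup i k (Ret w))) => //=.
  - by move=> j; rewrite proj_place.
  - by case/andP: open => _ /negbTE.
  - split=> // E; case/andP: open => _ /negP []; apply: (committed_closed inv).
    exact/(pi_stat inv).
  - exact: (pi_uniq inv).
  - by move=> k'; rewrite eqxx /=; case: eqP => [<-|//]; rewrite lg.
  - by move=> k' r [<- <-]; rewrite lg.
  - by move=> q k' j; left.
apply: (order_inv_quiet inv (x := Lookup i k (Ret w)) (or_intror (conj erefl isT)) _ oi) => //.
- exact: Or33.
- by move=> p; rewrite le_limit_refl.
Qed.

Hypothesis nversions_gt0 : (0 < nversions)%N.

Lemma read_step del s H i k s' r :
  invariant s H -> can_invoke s i -> logged s i k = None ->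
  shared_read hash s i k = (s', r) ->
  invariant (log_read del s' i k r)
    (rcons H (if del then Delete i k r else Lookup i k r)).
Proof.
case=> sg [kp [clk [rd [inv oi]]]] open lg.
have aborted s1 : limits_step s s1 i ->
    invariant (abort s1 i) (rcons H (if del then Delete i k Aborted else Lookup i k Aborted)).
  move=> ls; have Ei : txn (if del then Delete i k (@Aborted V) else Lookup i k Aborted) = i.
    by case: (del).
  rewrite -{1}Ei; apply: (abort_step inv oi); rewrite ?Ei //; by case: (del).
(* The sequential half, common to both successful cases; a delete logs nil whatever value it
   returns. *)
have returned w x s1 rd' : x = (if del then Delete i k (Ret w) else Lookup i k (Ret w)) ->
    begun s1 = begun s ->
    (forall p, [/\ log (tx s1 p) = log (tx s p), stat (tx s1 p) = stat (tx s p)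
       & closed (tx s1 p) = closed (tx s p)]) ->
    (forall q k' j, rd q k' = Some j -> rd' q k' = Some j) ->
    (exists2 j, rd' i k = Some j & value_of H k j w) ->
    (forall q k' j, rd' q k' = Some j -> rd q k' = Some j \/ q = i /\ k' = k) ->
    program_inv (log_read del s1 i k (Ret w)) (rcons H x) rd'.
  move=> Ex Eb Etx mono [j rj vj] back.
  pose w' := if del then None else w.
  have Es : log_read del s1 i k (Ret w) = put_log s1 i k w' del by rewrite /w'; case: (del).
  have lg1 p k' : logged s1 p k' = logged s p k' by rewrite /logged; have [-> _ _] := Etx p.
  have Ei : txn x = i by rewrite Ex; case: (del).
  rewrite Es; apply: (program_inv_step inv (x := x)); rewrite ?Ei //=.
  - by rewrite Ex; case: (del).
  - by rewrite Ex; case: (del).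
  - by move=> p /negbTE ->; have [-> -> ->] := Etx p.
  - have [_ _ h] := Etx i; rewrite eqxx /= h; case/andP: open => _ /negbTE ->.
    by rewrite Ex; case: (del).
  - have [_ h _] := Etx i; rewrite eqxx /= h; split; last by rewrite Ex; case: (del).
    move=> E; case/andP: open => _ /negP []; apply: (committed_closed inv).
    exact/(pi_stat inv).
  - apply: (put_log_uniq (s := s1)); have [-> _ _] := Etx i; exact: (pi_uniq inv).
  - move=> k'; rewrite logged_put_log lg1 eqxx /= Ex /w'; case: (del) => /=;
      rewrite eqxx (eq_sym k k') /=; by case: eqP.
  - move=> k'; rewrite logged_put_log lg1 eqxx /= Ex /w'; case: (del) => /=;
      rewrite ?eqxx ?(eq_sym k k') /=; case: eqP => // ->; by rewrite lg.
  - move=> k' r' E; have [Ek Er] : k = k' /\ w = r' by move: E; rewrite Ex; case: (del) => -[].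
    rewrite -Ek lg -Er; exists j => //.
    case: vj => [?|[cj wj]]; [by left|right].
    have ext l : proj l (rcons H x) = proj l (rcons H x) by [].
    rewrite (ext_tryC ext) cj orbT; split=> //.
    rewrite (ext_written ext) wj write_step_other // Ei.
    apply: contraTneq open => Eij; rewrite Eij /can_invoke (committed_closed inv cj) andbF //.
  - move=> q k' j' /back [|[-> ->]]; [by left|right].
    by rewrite logged_put_log !eqxx.
rewrite /shared_read; case: ifP => [_ [<- <-]|nf]; first by apply: aborted; apply: limits_step_refl.
have Li : stat (tx s i) = Live by apply: (open_live inv) => //; case/andP: open.
have back j q k' j' : upd_read rd i k j q k' = Some j' ->
    rd q k' = Some j' \/ q = i /\ k' = k.
  rewrite /upd_read; case: (q =P i) => [->|_] /=; last by left.
  by case: (k' =P k) => [->|_]; [right|left].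
(* An unlogged key has not been read before, so [upd_read] overwrites no earlier record. *)
have nr : rd i k = None.
  case E: (rd i k) => [j|//]; have := pi_accessed inv E.
  by rewrite (pi_view inv) lg.
have mono j q k' j' : rd q k' = Some j' -> upd_read rd i k j q k' = Some j'.
  rewrite /upd_read; case: (q =P i) => [->|_] //=; by case: (k' =P k) => [->|_] //; rewrite nr.
pose x (w : option V) := if del then Delete i k (Ret w) else Lookup i k (Ret w).
have Exi w : txn (x w) = i by rewrite /x; case: (del).
have openx w : (txn (x w) \in begun s) && ~~ closed (tx s (txn (x w))) by rewrite Exi.
have nbx w : ~~ begins (txn (x w)) (x w) by rewrite /x; case: (del).
have ntx w : ~~ terminates (x w) by rewrite /x; case: (del).
case fn: (find_node s k) => [nd|]; last first.
  case=> <- <-; exists sg, kp, clk, (upd_read rd i k 0); split.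
    apply: (returned None (x None)) => //.
    - exact: mono.
    - by exists 0; [rewrite /upd_read !eqxx|left].
    - exact: back.
  have := @order_inv_read_fresh s
    (log_read del (put_node hash s (Node k true [:: initial_version V i])) i k (Ret None))
    H sg kp clk rd (x None) inv oi (openx _) (nbx _) k nversions_gt0 (ntx _) fn.
  rewrite Exi => hstep; apply: hstep => //.
  - by rewrite /log_read; case: (del).
  - by rewrite /log_read; case: (del).
  - by move=> k'; rewrite -find_put_node /log_read; case: (del).
  - by move=> p; rewrite /log_read; case: (del) => /=; case: eqP => [->|].
case fv: (find_version (vl nd) i) => [[v next]|]; last first.
  by case=> <- <-; apply: aborted; apply: limits_step_refl.
set hi := (if next is Some w then _ else _); set lo := maxn _ _.
case: ifP => [_|nex] [<- <-].
  (* The limits stay tightened although the read aborts. *)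
  apply: aborted; split=> //= [p|p|p|p|p||p]; try by case: eqP => [->|].
  - by case: eqP => [->|_] //=; apply: leq_maxl.
  - case: eqP => [->|_] /=; last exact: le_limit_refl.
    by rewrite /hi; case: (next) => [w|]; [apply: le_min_limit|apply: le_limit_refl].
  - by rewrite eqxx.
  - by left; case: eqP => [->|].
set s1 := put_node _ _ _.
have Es1 : begun s1 = begun s /\ forall p, tx s1 p = if p == i then set_limits (tx s i) lo hi else tx s p.
  by [].
exists (upd sg i (maxn (sg i) (vrt v))), (upd kp i clk), clk.+1, (upd_read rd i k (ts v)).
split.
  apply: (returned _ (x (vval v))) => // [p|||]; last exact: back.
  - by have [_ ->] := Es1; case: eqP => [->|].
  - exact: mono.
  - exists (ts v); first by rewrite /upd_read !eqxx.
    have := oi_node oi k; rewrite /node_inv fn => -[srt _ vok _ _].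
    have [A [B [/= Evs _ _ _ _]]] := find_versionP srt fv.
    have vin : In v (vl nd) by rewrite Evs List.in_app_iff /=; auto.
    by case: (vok v vin) => [[? [? _]]|[? ? _]]; [left|right].
have := @order_inv_read s (log_read del s1 i k (Ret (vval v)))
    H sg kp clk rd (x (vval v)) inv oi (openx _) (nbx _) k nd (mark nd) v next hi.
rewrite Exi => hstep; apply: hstep => //.
- by rewrite nex.
- by rewrite /log_read; case: (del).
- by rewrite /log_read; case: (del).
- move=> k'; rewrite /log_read; case: (del);
    by rewrite -[LHS]/(find_node s1 k') find_put_node.
- by move=> p /negbTE pi_; rewrite /log_read; case: (del); rewrite /= !pi_.
- by rewrite /log_read; case: (del); rewrite /= !eqxx.
Qed.

Lemma begin_step s H i its0 :
  invariant s H -> i \notin begun s -> 0 < i -> (its0 <= gcounter s)%N ->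
  invariant (start s i its0) (rcons H (Begin i)).
Proof.
case=> sg [kp [clk [rd [inv oi]]]] ni i0 le.
exists (upd sg i (gcounter s)), (upd kp i clk), clk.+1, rd.
split; last exact: order_inv_begin.
have lg k : logged s i k = None by apply: (fresh_logged k inv).
apply: (program_inv_step inv (x := Begin i)) => //=; rewrite ?eqxx //.
- by move=> p /negbTE ->.
- by move=> k; rewrite lg /logged /= eqxx.
- by move=> k; rewrite lg /logged /= eqxx.
- by move=> q k j; left.
Qed.

Lemma tryC_step incrVal each_key s H i s' b :
  invariant s H -> can_invoke s i ->
  tryC nversions incrVal hash each_key s i = (s', b) ->
  invariant s' (rcons H (TryC i b)).
Proof.
case=> sg [kp [clk [rd [inv oi]]]] open; rewrite /tryC.
case: ifP => [_ [<- <-]|nf].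
  by apply: (abort_step (x := TryC i false) inv oi) => //; apply: limits_step_refl.
have Li : stat (tx s i) = Live by apply: (open_live inv) => //; case/andP: open.
have nfi : stat (tx s i) <> StFalse by rewrite Li.
case E: (validate _ _ _ _ _ _ _) => [s1 []] [<- <-]; last first.
  apply: (abort_step (x := TryC i false) inv oi) => //; exact: (validate_step E).
have ls := validate_step E.
set us := updates s i in E *; set s2 := foldl _ _ _.
have [Et2 Eb2 Eg2] : [/\ tx s2 = tx s1, begun s2 = begun s1 & gcounter s2 = gcounter s1].
  exact: apply_updates_tx.
have Etx p : tx (set_tx s2 i (close (tx s2 i) Committed)) p =
    if p == i then close (tx s1 i) Committed else tx s1 p by rewrite /= Et2.
have prog : program_inv (set_tx s2 i (close (tx s2 i) Committed)) (rcons H (TryC i true)) rd.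
  apply: (program_inv_close (x := TryC i true) (st := Committed) inv ls) => //=.
  by rewrite Eb2 (ls_begun ls).
(* Without updates no check is run: T_i commits with the key it has. *)
have [us0|us0] : us = [::] \/ us <> [::] by case: (us); [left|right].
  exists sg, kp, clk, rd; split=> //.
  apply: (order_inv_close (x := TryC i true) (st := Committed) inv oi ls) => //=.
  - by right.
  - move=> k; apply/orP; right; have := entry_updates k (pi_uniq inv i).
    rewrite -/us us0 (pi_written inv).
    by case: (logged s i k) => [[w []]|].
  - by right.
  - by rewrite /s2 us0.
  - by rewrite Eb2 (ls_begun ls).
exists (upd sg i (tltl (tx s1 i))), (upd kp i clk), clk.+1, rd; split=> //.
exact: (order_inv_commit (x := TryC i true) inv oi open _ nversions_gt0 erefl E us0 Li erefl).
Qed.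

Lemma execution_invariant incrVal (C : R) each_key s H : 0 < C ->
  execution nversions incrVal C hash each_key s H -> invariant s H.
Proof.
move=> C0; elim=> {s H}.
- exists (fun=> 0%N), (fun=> 0%N), 0%N, (fun _ _ => None); split.
    by split=> // [? []|? []].
  by split.
- move=> s H _ IH i ni; have [sg [kp [clk [rd [inv oi]]]]] := IH.
  apply: begin_step => //; rewrite /i /wts subrr mulr0 addr0 ltr0n.
  exact: (oi_gcounter oi).
- move=> s H a _ IH ab _ i ni; have [sg [kp [clk [rd [inv oi]]]]] := IH.
  have le := oi_its oi ab; apply: begin_step => //; rewrite /i /wts.
  (* The correction [C * (cts - its)] is nonnegative, so a retry also gets a timestamp above that of
     T_0. *)
  apply: ltr_pwDl; first by rewrite ltr0n (oi_gcounter oi).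
  by apply: mulr_ge0; [exact: ltW|rewrite subr_ge0 ler_nat].
- by move=> s H i k w u _ IH open lg; apply: log_lookup_step lg.
- move=> s H i k w u _ IH open lg; apply: log_step => //=.
  + by move=> k'; rewrite eqxx eq_sym; case: eqP.
  + by move=> k'; rewrite eqxx eq_sym; case: eqP.
  + by move=> k' r [<- <-]; exists u.
- by move=> s H i k s' r _ IH open lg sr; apply: (read_step false) sr.
- by move=> s H i k s' r _ IH open lg sr; apply: (read_step true) sr.
- move=> s H i k v _ IH open; apply: log_step => //=.
  + by move=> k'; rewrite eqxx eq_sym; case: eqP.
  + by move=> k'; rewrite eqxx eq_sym; case: eqP.
- by move=> s H i s' b _ IH open tc; apply: tryC_step tc.
- move=> s H i _ [sg [kp [clk [rd [inv oi]]]]] open.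
  by apply: (abort_step (x := TryA i) inv oi) => //; apply: limits_step_refl.
Qed.

Lemma klt_irr sg kp : irreflexive (klt sg kp).
Proof. by move=> i; rewrite /klt !ltnn andbF. Qed.

Lemma klt_trans sg kp : transitive (klt sg kp).
Proof. by move=> j i l; rewrite /klt; lia. Qed.

(** * Sub-histories *)

Section Subhistory.
Variables (s : state) (sg kp : R -> nat) (clk : nat) (rd : R -> K -> option R).
Variables (H1 H2 : seq event) (A : pred R) (o : option R).
Let H := H1 ++ H2.
Let tail : seq event := if o is Some p then [:: Commit p] else [::].
Let G := [seq x <- H1 | A (txn x)] ++ tail.
Hypothesis inv : program_inv s H rd.
Hypothesis oi : order_inv s H sg kp clk rd.

(** Nothing follows a terminating event of a transaction, so one that commits within [H1] lies
    wholly in it. *)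
Lemma committed_proj i : has (tryC_commits i) H1 -> proj i H2 = [::] /\
  exists2 B, proj i H1 = rcons B (TryC i true) & ~~ has (@terminates R K V) B.
Proof.
rewrite -(has_proj _ (@tryC_commits_txn _ _ _ i)) => /has_split [B [e [Q [E ce]]]].
have EH : proj i H = B ++ e :: (Q ++ proj i H2) by rewrite proj_cat E -catA.
have te := tryC_commits_terminates ce.
have := pi_last inv EH te; case: Q E EH => //= E EH E2; split=> //.
have -> : TryC i true = e by move: ce; case: (e) => //= ? [] // /eqP ->.
exists B; first by rewrite -cats1.
apply/negP => /has_split [B1 [t [B2 [EB tt]]]].
have := pi_last inv (i := i) (B := B1) (e := t) (Q := B2 ++ [:: e]).
rewrite EH EB E2 -catA => /(_ erefl tt).
by case: (B2).
Qed.

Lemma committed_sees q j : has (tryC_commits q) H1 -> sees H q j ->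
  has (tryC_commits j) H1.
Proof.
move=> /[dup] /committed_proj [E2 [B E1 nB]] /has_split [P1 [t [P2 [E ct]]]].
have tq := tryC_commits_txn ct.
have EH : proj q H = proj q P1 ++ t :: (proj q P2 ++ proj q H2).
  by rewrite /H E -catA proj_cat /= tq eqxx proj_cat.
have nil := pi_last inv EH (tryC_commits_terminates ct).
rewrite /H E /sees -catA /= => h; rewrite has_cat (before_cat_has h) //.
apply/negP => h2; have : has (succeeds q) (proj q (P2 ++ H2)).
  by rewrite has_proj // => y /andP [/eqP].
by rewrite proj_cat nil.
Qed.

Hypothesis vH : valid H.
Hypothesis AH1 : forall i, A i -> i \in txns H1.
Hypothesis A_ends : forall i, A i -> has (tryC_commits i) H1 \/ o = Some i.
Hypothesis A_committed : forall i, has (tryC_commits i) H1 -> A i.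
Hypothesis o_open : forall p, o = Some p -> A p /\ ~~ has (@terminates R K V) (proj p H1).
(** A commit counts for [oi_vis] if the status of the reader is not false or if the reader succeeds
    after it; the second alternative serves the aborted transaction that the cut closes by
    [Commit]. *)
Hypothesis A_visible : forall q i, A q -> has (tryC_commits i) H1 ->
  stat (tx s q) <> StFalse \/ sees H q i.
Hypothesis A_sees : forall q j, A q -> sees H q j -> has (tryC_commits j) H1.

Let proj_filter i (l : seq event) : proj i [seq x <- l | A (txn x)] = if A i then proj i l else [::].
Proof.
rewrite /proj -filter_predI; case Ai: (A i).
  by apply: eq_filter => y /=; case: eqP => // ->.
rewrite -(filter_pred0 l); apply: eq_filter => y /=.
by case: eqP => // ->.
Qed.

Let committed_closes i : has (tryC_commits i) H1 -> o <> Some i.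
Proof.
move=> c /o_open [_ /negP]; apply.
rewrite -(has_proj _ (@tryC_commits_txn _ _ _ i)) in c.
apply: sub_has c; exact: tryC_commits_terminates.
Qed.

Let projG i : proj i G = if A i then proj i H1 ++ (if o == Some i then [:: Commit i : event] else [::]) else [::].
Proof.
rewrite proj_cat proj_filter /tail; case: o o_open => [p|] h /=; last by case: (A i); rewrite ?cats0.
have [Ap _] := h p erefl; rewrite -[Some p == Some i]/(p == i); case: eqP => [<-|_].
  by rewrite Ap.
by case: (A i); rewrite ?cats0.
Qed.

Let projG_committed i : has (tryC_commits i) H1 -> proj i G = proj i H.
Proof.
move=> c; rewrite projG A_committed // proj_cat; have [-> _] := committed_proj c.
by case: eqP => // /(committed_closes c).
Qed.

Let tryC_G i : has (tryC_commits i) G = has (tryC_commits i) H1.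
Proof.
apply/idP/idP => [|c].
  rewrite has_cat => /orP [|]; last by rewrite /tail; case: (o).
  case/has_split => [B [e [Q [E ce]]]].
  by have [P' [Q' [-> _]]] := filter_eq_split E; rewrite has_cat /= ce orbT.
rewrite -(has_proj _ (@tryC_commits_txn _ _ _ i)) projG_committed //.
by rewrite has_proj ?has_cat ?c // => y; apply: tryC_commits_txn.
Qed.

Let txns_G i : i \in txns G -> A i.
Proof. by rewrite mem_txn_proj projG; case: (A i). Qed.

Let H1_H i : has (tryC_commits i) H1 -> has (tryC_commits i) H.
Proof. by rewrite has_cat => ->. Qed.

(** The source of a read commits before it, within [H1], and all such transactions are kept. *)
Lemma subhistory_valid : valid G.
Proof.
move=> P e Q i k r EG re.
have ei : txn e = i by case: (e) re => //= [? ? [?|]|? ? [?|]] // [-> _ _].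
have [[B EB]|[B _ E]] := cat_eq_split EG; last first.
  have : has (fun e => isSome (returns e)) tail by rewrite E has_cat /= re orbT.
  by rewrite /tail; case: (o).
have [P' [Q' [E EP]]] := filter_eq_split EB.
have Ai : A i.
  by apply: txns_G; rewrite EG map_cat mem_cat /= inE ei eqxx orbT.
have EH : H = P' ++ e :: (Q' ++ H2) by rewrite /H E -catA.
have := vH EH re; rewrite EP -own_view_proj -(own_view_proj _ _ (filter _ _)) proj_filter Ai.
case: (own_view i k (proj i P')) => // -[->|[j cj wj]]; first by left.
have Aj : A j by apply: A_committed; rewrite E has_cat cj.
right; exists j.
  rewrite -(has_proj _ (@tryC_commits_txn _ _ _ j)) proj_filter Aj.
  by rewrite has_proj // => y; apply: tryC_commits_txn.
by rewrite -written_proj proj_filter Aj written_proj.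
Qed.

(** The order by final keys is restricted to the transactions kept: [A_visible] makes [oi_vis]
    applicable to every writer in the cut, and [A_sees] keeps the source of each read inside. *)
Lemma subhistory_opaque : opaque G.
Proof.
apply: (@opaque_of_order _ _ _ _ (klt sg kp)).
- exact: klt_irr.
- exact: klt_trans.
- move=> i j iG jG ij.
  have b l : l \in txns G -> l \in begun s.
    by move/txns_G/AH1; rewrite (pi_begun inv) map_cat mem_cat => ->.
  have : kp i != kp j by apply: contra ij => /eqP /(oi_inj oi (b _ iG) (b _ jG)) ->.
  by rewrite /klt; lia.
- exact: subhistory_valid.
- move=> i /txns_G Ai; have iH1 := AH1 Ai.
  have [|B EB] := pi_begin inv (i := i).
    by rewrite map_cat mem_cat iH1.
  rewrite -(has_proj _ (@begins_txn _ _ _ i)) projG Ai has_cat.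
  move: iH1 EB; rewrite mem_txn_proj /H proj_cat.
  by case: (proj i H1) => //= e l _ [-> _]; rewrite /= eqxx.
- move=> i /txns_G Ai; case: (A_ends Ai) => [c|oE].
    have [E2 [B E1 nB]] := committed_proj c; exists B, (TryC i true).
    by rewrite projG_committed // proj_cat E2 E1 cats0.
  have [_ nt] := o_open oE; exists (proj i H1), (Commit i).
  by rewrite projG Ai oE eqxx cats1.
(* The added [Commit] is the last event, so nothing begins after it. *)
- move=> i j /precedes_before h; apply: (oi_rt oi); apply: before_catl.
  apply: (@before_filter _ _ _ (fun x => A (txn x))).
  move: h; rewrite /G /tail; case: (o) => [p|]; last by rewrite cats0.
  by rewrite cats1 before_rcons andbF orbF.
move=> q B1 e B2 k r; rewrite projG; case Aq: (A q); last by case: (B1).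
move=> E re.
have [[B E1]|[B _ Et]] := cat_eq_split E; last first.
  move: Et; case: ifP => _; last by case: (B).
  by case: B => [|? []] //= [Ee _]; rewrite -Ee in re.
have EH : proj q H = B1 ++ e :: (B ++ proj q H2) by rewrite proj_cat E1 -catA.
have := pi_read inv EH re; case: (own_view q k B1) => // -[j rj vj].
have wG i : has (tryC_commits i) G -> written i k G <> None ->
    has (tryC_commits i) H1 /\ writer H k i.
  rewrite tryC_G => c; rewrite -written_proj projG_committed // written_proj => w; split=> //.
  by rewrite /writer H1_H //; case: (written i k H) w.
have [qb jq hj] := oi_rd oi rj.
have pos i : has (tryC_commits i) H -> 0 < i.
  by move/(committed_begun inv)/(oi_pos oi).
(* For a read from T_0, [oi_vis] would push a writer smaller than [q] down to 0, against the
   positivity of timestamps. *)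
case: vj => [[j0 ->]|[cj wj]].
  left; split=> // i ci iq /(wG i ci) [c wi].
  have iq' : i <> q by apply/eqP.
  have [a b] := oi_vis oi rj wi iq' (A_visible Aq c).
  have [iltq|qi|//] := ltgtP i q; last exact: b.
  by have := a iltq; rewrite j0 leNgt pos // H1_H.
case: hj => [j0|[_ kj sj _]]; first by have := pos _ cj; rewrite j0 ltxx.
have cj1 := A_sees Aq sj.
right; exists j; split=> //; first by rewrite tryC_G.
  by rewrite -written_proj projG_committed // written_proj.
move=> i ci iq /(wG i ci) [c wi].
have iq' : i <> q by apply/eqP.
have [a b] := oi_vis oi rj wi iq' (A_visible Aq c).
have wrj : writer H k j by rewrite /writer cj wj.
(* Writers older than the source precede it by monotonicity of [sg]; by [oi_vis] a newer one has a
   timestamp above [q] and comes after [q]. *)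
case: (ltgtP i j) => [ij|ji|->]; last exact: Or31.
  by apply: Or32; rewrite /klt (oi_ww oi wi wrj ij).
have [iltq|qi|//] := ltgtP i q; last by apply/Or33/b.
by have := a iltq; rewrite leNgt ji.
Qed.

End Subhistory.

Lemma subhist_opaque s H G : invariant s H -> valid H -> subhist H G -> opaque G.
Proof.
case=> sg [kp [clk [rd [inv oi]]]] vH sub; case: sub inv oi vH => {G}.
- move=> P e Q EH nae allQ hasQ inv oi vH; set p := txn e.
  have E : H = rcons P e ++ Q by rewrite cat_rcons.
  rewrite E in inv oi vH.
  (* The events of [p] left in [Q] exclude a termination before the cut. *)
  have nt : ~~ has (@terminates R K V) (proj p (rcons P e)).
    apply/negP => /has_split [B [t [B' [EB tt]]]].
    have := pi_last inv (i := p) (B := B) (e := t) (Q := B' ++ proj p Q).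
    rewrite proj_cat EB -catA => /(_ erefl tt).
    have : ~~ nilp (proj p Q) by rewrite -mem_txn_proj mem_txn.
    by case: (B') => //=; case: (proj p Q).
  have ncp : ~~ has (tryC_commits p) (rcons P e).
    apply: contra nt; rewrite -(has_proj _ (@tryC_commits_txn _ _ _ p)).
    apply: sub_has; exact: tryC_commits_terminates.
  have inP i : has (tryC_commits i) (rcons P e) -> has (tryC_commits i) P.
    rewrite has_rcons => /orP [c|//]; have := tryC_commits_txn c => Ei.
    by case/negP: ncp; rewrite has_rcons /p Ei c.
  rewrite -cats1.
  apply: (subhistory_opaque (s := s) (o := Some p) inv oi vH
    (A := fun i => has (tryC_commits i) P || (i == p))).
  + move=> i; rewrite map_rcons mem_rcons inE => /orP [c|/eqP ->]; last by rewrite eqxx.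
    by apply/orP; right; rewrite mem_txn; apply: sub_has c => y /tryC_commits_txn ->.
  + by move=> i /orP [c|/eqP ->]; [left; rewrite has_rcons c orbT|right].
  + by move=> i /inP ->.
  + by move=> _ [<-]; rewrite eqxx orbT.
  + move=> q i /orP [cq|/eqP ->] c.
      left; suff -> : stat (tx s q) = Committed by [].
      by apply/(pi_stat inv); rewrite has_cat has_rcons cq orbT.
    (* T_p may have been aborted by a writer, but [e] is a success that follows all the commits of
       the cut. *)
    right; rewrite cat_rcons; apply: before_cat; first exact: inP.
    by rewrite /succeeds eqxx.
  move=> q j /orP [cq|/eqP ->] sj.
    by apply: (committed_sees inv _ sj); rewrite has_rcons cq orbT.
  (* As [e] is the last success of T_p, any commit it sees occurs in [P]. *)
  rewrite cat_rcons in sj; rewrite has_rcons (before_cat_has sj) ?orbT //.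
  move: allQ; rewrite -all_predC; apply: sub_all => y /=.
  by rewrite /succeeds negb_and negbK -implybE.
move=> P l Q EH last inv oi vH.
have E : H = rcons P (TryC l true) ++ Q by rewrite cat_rcons.
rewrite E in inv oi vH.
set A := fun i => has (tryC_commits i) P || (i == l).
have Ac i : A i -> has (tryC_commits i) (rcons P (TryC l true)).
  by rewrite has_rcons /= orbC eq_sym.
rewrite -[X in opaque X]cats0.
apply: (subhistory_opaque (s := s) (o := None) (A := A) inv oi vH) => //.
- move=> i /Ac c; rewrite mem_txn; apply: sub_has c => y /tryC_commits_txn ->; exact: eqxx.
- by move=> i /Ac; left.
- by move=> i; rewrite has_rcons /= orbC eq_sym.
- move=> q i /Ac cq _; left; suff -> : stat (tx s q) = Committed by [].
  by apply/(pi_stat inv); rewrite has_cat cq.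
- by move=> q j /Ac cq; apply: (committed_sees inv).
Qed.

End Protocol.

Theorem theorem7 (R : realDomainType) (disp : Order.disp_t)
    (K : orderType disp) (V : Type) (M nversions incrVal : nat) (C : R)
    (hash : K -> 'I_M) (each_key : bool)
    (hnversions : (1 <= nversions)%N) (hC : 0 < C) (hincr : (1 <= incrVal)%N)
    (H : seq (event R K V))
    (Hgen : generated nversions incrVal C hash each_key H)
    (Hvalid : valid H) :
  locally_opaque H.
Proof.
case: Hgen => s /(execution_invariant hnversions hC) inv G.
exact: subhist_opaque inv Hvalid.
Qed.
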